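(* Let $(E,\lambda)$ be a connectivity system, $k\geq 1$ an integer, and $\mathcal{P}$ a set of $k$-profiles which all have the same truncation to a $(k-1)$-profile. Let $\Phi$ be a $\leq$-maximal $k$-pseudoflower which has a concatenation into a $k$-daisy and distinguishes at least three profiles in $\mathcal{P}$. Then $\Phi$ is $\preccurlyeq$-maximal.
   Context: $\mathbb{N}$ contains $0$. A connectivity system is a (possibly infinite) set $E$ with a map $\lambda:2^E\to\mathbb{N}\cup\{\infty\}$ such that for all $A,B\subseteq E$: $\lambda(A)=\lambda(E\setminus A)$, $\lambda(A)+\lambda(B)\geq\lambda(A\cup B)+\lambda(A\cap B)$, and $\lambda$ is limit-closed: if $n\in\mathbb{N}$ and $(A_i)_{i\in I}$ is a (non-empty) chain with respect to inclusion of subsets of $E$ with $\lambda(A_i)\le n$ for all $i$, then $\lambda(\bigcup_{i}A_i)\leq n$. The value $\lambda(A)$ is the order of $A$. Profiles: let $S_l=\{S\subseteq E:\lambda(S)<l\}$. An $l$-profile is a subset $P\subseteq S_l$ such that (i) for every $S\in S_l$, $P$ contains exactly one of $S$ and $E\setminus S$; (ii) if $R,S\in S_l$ with $R\subsetneq S\in P$ then $R\in P$; (iii) if $R,S\in P$ then $E\setminus(R\cup S)\notin P$. The truncation of a $k$-profile $P$ to a $(k-1)$-profile is $P\cap S_{k-1}$. A set $S$ distinguishes two $k$-profiles if one of them contains $S$ and the other contains $E\setminus S$. A cyclic order on a set $I$ is a total strict cyclic order; $]x,y[$ is the set of elements strictly between $x$ and $y$ when going from $x$ to $y$. An interval of $I$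 is a subset $Y\subseteq I$ such that for all distinct $x,z\in Y$ at least one of $]x,z[$ and $]z,x[$ is contained in $Y$; it is non-trivial if $Y\notin\{\emptyset,I\}$. A $k$-pseudoflower is a partition $(P_i)_{i\in I}$ of $E$ (into non-empty classes, called petals) with a cyclically ordered index set $I$ such that the union of any interval of partition classes has order at most $k-1$; the sets displayed by it are the unions $\bigcup_{i\in I'}P_i$ for non-trivial intervals $I'$ of $I$. A concatenation of a $k$-pseudoflower $(P_i)_{i\in I}$ is a $k$-pseudoflower $(Q_i)_{i\in I'}$ such that for every $i\in I$ there is $f(i)\in I'$ with $P_i\subseteq Q_{f(i)}$, and such that for all intervals $I''$ of $I'$ the set $f^{-1}(I'')$ is an interval of $I$. If $\Phi$ is a concatenation of $\Psi$ one writes $\Phi\leq\Psi$. A $k$-flower is a $k$-pseudoflower with at least four petals in which the union of any non-trivial interval of petals has order exactly $k-1$. A $k$-daisy is a $k$-flower such that every concatenation of it with finitely many petals has the property that the non-trivial unions of petals (unions of a non-empty proper subset of the petals) which have order $k-1$ are exactly those where the indices of the petals form an interval of the index set. A $k$-pseudoflower $\Phi$ distinguishes at least three profiles in $\mathcal{P}$ if there are three elements of $\mathcal{P}$ that are pairwise distinguished by sets displayed by $\Phi$. For $k$-pseudoflowers $\Phi,\Psi$ write $\Phi\preccurlyeq\Psi$ if every two profiles in $\mathcal{P}$ that are distinguished by the union of an interval of (petals of) $\Phi$ are also distinguished by the union of an interval of (petals of) $\Psi$. An element $\Phi$ of a pre-order is maximal if $\Phi\leq\Psi$ implies $\Psi\leq\Phi$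 (similarly for $\preccurlyeq$); here both pre-orders are considered on the set of all $k$-pseudoflowers of $(E,\lambda)$. *)

(* Defs.v *)
From mathcomp Require Import all_boot.
From mathcomp Require Import boolp classical_sets functions cardinality.

Set Implicit Arguments.
Unset Strict Implicit.
Unset Printing Implicit Defensive.

Local Open Scope classical_set_scope.

(* The extended naturals; [None] is infinity. *)
Definition enat := option nat.

Definition enat_add (x y : enat) : enat :=
  match x, y with
  | Some m, Some n => Some (m + n)
  | _, _ => None
  end.

Definition enat_le (x y : enat) : bool :=
  match x, y with
  | _, None => true
  | Some m, Some n => m <= n
  | None, Some _ => false
  end.

Definition enat_lt (x y : enat) : bool := ~~ enat_le y x.

Record connectivity (E : Type) := Connectivity {
  order_of :> set E -> enat;
  order_ofC : forall A, order_of A = order_of (~` A);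
  order_of_submod : forall A B,
    enat_le (enat_add (order_of (A `|` B)) (order_of (A `&` B)))
            (enat_add (order_of A) (order_of B));
  order_of_limit : forall (n : nat) (C : set (set E)),
    C !=set0 -> total_on C (fun A B => A `<=` B) ->
    (forall A, C A -> enat_le (order_of A) (Some n)) ->
    enat_le (order_of (\bigcup_(A in C) A)) (Some n)
}.

Section Profiles.
Variables (E : Type) (lam : connectivity E).

Definition small_sets (l : nat) : set (set E) :=
  [set S | enat_lt (lam S) (Some l)].

Definition is_profile (l : nat) (P : set (set E)) : Prop :=
  [/\ P `<=` small_sets l,
      forall S, small_sets l S ->
        (P S /\ ~ P (~` S)) \/ (~ P S /\ P (~` S)),
      forall R S, small_sets l R -> small_sets l S ->
        R `<` S -> P S -> P R
    & forall R S, P R -> P S -> ~ P (~` (R `|` S))].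

(* The truncation of a k-profile to a (k-1)-profile. *)
Definition truncation (k : nat) (P : set (set E)) : set (set E) :=
  P `&` small_sets k.-1.

Definition distinguishes (S : set E) (P Q : set (set E)) : Prop :=
  (P S /\ Q (~` S)) \/ (Q S /\ P (~` S)).

End Profiles.

Record cyclic_order (I : Type) := CyclicOrder {
  cyc :> I -> I -> I -> Prop;
  cyc_rot : forall x y z, cyc x y z -> cyc y z x;
  cyc_asym : forall x y z, cyc x y z -> ~ cyc z y x;
  cyc_trans : forall x y z w, cyc x y z -> cyc x z w -> cyc x y w;
  cyc_total : forall x y z, x <> y -> y <> z -> x <> z ->
    cyc x y z \/ cyc z y x
}.

(* Maximality in a pre-order, which need not be antisymmetric. *)
Definition maximal_for (T : Type) (le : T -> T -> Prop) (x : T) : Prop :=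
  forall y, le x y -> le y x.

Section Intervals.
Variables (I : Type) (c : cyclic_order I).

(* ]x, y[ in the cyclic order. *)
Definition strictly_between (x y : I) : set I := [set z | c x z y].

Definition is_interval (Y : set I) : Prop :=
  forall x z, Y x -> Y z -> x <> z ->
    strictly_between x z `<=` Y \/ strictly_between z x `<=` Y.

Definition nontrivial (Y : set I) : Prop := Y <> set0 /\ Y <> [set: I].

End Intervals.

Record pseudoflower (E : Type) (lam : connectivity E) (k : nat) := Pseudoflower {
  petal_index : Type;
  index_cyc : cyclic_order petal_index;
  petal : petal_index -> set E;
  petal_partition : partition [set: petal_index] petal [set: E];
  petal_interval : forall J : set petal_index, is_interval index_cyc J ->
    enat_le (lam (\bigcup_(i in J) petal i)) (Some k.-1)
}.

Section Pseudoflowers.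
Variables (E : Type) (lam : connectivity E) (k : nat).
Implicit Types Phi Psi : pseudoflower lam k.

Definition petal_union Phi (J : set (petal_index Phi)) : set E :=
  \bigcup_(i in J) petal i.

Definition displayed Phi (S : set E) : Prop :=
  exists J : set (petal_index Phi),
    [/\ is_interval (index_cyc Phi) J, nontrivial J & S = petal_union J].

Definition concatenation Phi Psi : Prop :=
  exists f : petal_index Psi -> petal_index Phi,
    (forall i, petal i `<=` petal (f i)) /\
    (forall J : set (petal_index Phi), is_interval (index_cyc Phi) J ->
       is_interval (index_cyc Psi) (f @^-1` J)).

Definition is_flower Phi : Prop :=
  ([set: 'I_4] #<= [set: petal_index Phi])%card /\
  forall J : set (petal_index Phi), is_interval (index_cyc Phi) J -> nontrivial J ->
    lam (petal_union J) = Some k.-1.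

Definition is_daisy Phi : Prop :=
  is_flower Phi /\
  forall Psi, concatenation Psi Phi -> finite_set [set: petal_index Psi] ->
    forall J : set (petal_index Psi), nontrivial J ->
      (lam (petal_union J) = Some k.-1 <-> is_interval (index_cyc Psi) J).

Definition distinguishes_three (PP : set (set (set E))) Phi : Prop :=
  exists P Q R : set (set E), [/\ PP P, PP Q & PP R] /\
    [/\ exists2 S, displayed Phi S & distinguishes S P Q,
        exists2 S, displayed Phi S & distinguishes S P R
      & exists2 S, displayed Phi S & distinguishes S Q R].

Definition interval_distinguishes Phi (P Q : set (set E)) : Prop :=
  exists2 J : set (petal_index Phi), is_interval (index_cyc Phi) J
    & distinguishes (petal_union J) P Q.

Definition profile_le (PP : set (set (set E))) Phi Psi : Prop :=
  forall P Q, PP P -> PP Q ->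
    interval_distinguishes Phi P Q -> interval_distinguishes Psi P Q.

End Pseudoflowers.

(* Main.v *)
Require Import Defs.
From mathcomp Require Import all_boot.
From mathcomp Require Import boolp classical_sets functions cardinality.
From mathcomp Require Import zify.

(** Suppose that some interval of [Psi] distinguishes [P] from [Q], that no
    interval of [Phi] does, and that [Psi] distinguishes whatever [Phi] does.
    Of the three profiles distinguished by [Phi], two, [P1] and [P2], are
    distinguished by [Phi] from [P], hence from [Q].  So [Psi] distinguishes any
    two of [P], [Q], [P1], [P2]; these four sit at different places of the circle
    of petals of [Psi], and one interval of [Psi] splits both pairs at once:
    there is a set [X] of order at most [k - 1] which separates [P] from [Q] and
    [P1] from [P2] ([separate_pairs]).

    Since all profiles have the same truncation, a set that distinguishes two
    of them never has order less than [k - 1] ([distinguishing_ge]).  Fed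
    into submodularity, these lower bounds become upper bounds [k - 1] for
    the other corner of two crossing sets.

    The profile [P] orients all intervals of [Phi] towards one place of the
    circle, which is a petal or one side of a cut ([profile_location]), and [Q]
    lives at the same place.

    If the place is a petal, cut the circle there, so that the other petals form
    a line, and let [D] be an initial segment of it containing [P1] but not
    [P2].  Adding the petals in [D] to [X] and removing the later ones keeps
    the order at most [k - 1], so [X] now cuts only the petal where [P] and [Q]
    live.  Splitting that petal along [X] gives a pseudoflower strictly finer
    than [Phi] ([petal_splits]), against maximality.

    If the place is a cut, there is no petal to split; infinitely many petals
    accumulate at the cut.  By limit-closedness every long enough piece of the
    line near the cut is crossed by [X] with both halves of order at least
    [k - 1].  For three such consecutive pieces the union of the outer two has
    order at most [k - 1] ([uncross_alternate]), as in an anemone.  Uncrossing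
    with intervals carries this over to two opposite petals in a four-petal
    concatenation of the daisy ([classes_spread], [no_quartering]), where it
    contradicts the definition of a daisy. *)

Set Implicit Arguments.
Unset Strict Implicit.
Unset Printing Implicit Defensive.

Local Open Scope classical_set_scope.

(** * Uncrossing *)

Section Uncrossing.
Variables (E : Type) (lam : connectivity E) (K : nat).
Implicit Types A B : set E.

Definition order_le A := enat_le (lam A) (Some K).
Definition order_ge A := enat_le (Some K) (lam A).

Lemma order_leC A : order_le (~` A) = order_le A.
Proof. by rewrite /order_le -order_ofC. Qed.

Lemma order_geC A : order_ge (~` A) = order_ge A.
Proof. by rewrite /order_ge -order_ofC. Qed.

Lemma order_le_ge A : lam A = Some K <-> order_le A /\ order_ge A.
Proof.
rewrite /order_le /order_ge; case: (lam A) => [n|] /=; last by split=> [//|[]].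
by split=> [[->]|[le ge]]; [rewrite leqnn | congr Some; apply/eqP; rewrite eqn_leq le].
Qed.

Lemma order_le_or_ge A : order_le A \/ order_ge A.
Proof.
rewrite /order_le /order_ge; case: (lam A) => [n|] /=; last by right.
by case: (leqP n K) => [|/ltnW]; [left | right].
Qed.

(** The three forms in which submodularity is used; infinite orders are covered,
    as [order_ge] holds for them. *)
Lemma uncross_cap A B :
  order_le A -> order_le B -> order_ge (A `|` B) -> order_le (A `&` B).
Proof.
rewrite /order_le /order_ge; move: (order_of_submod lam A B).
case: (lam A) => [a|] //; case: (lam B) => [b|] //.
by case: (lam (A `|` B)) => [c|] //; case: (lam (A `&` B)) => [d|] //=; lia.
Qed.

Lemma uncross_cup A B :
  order_le A -> order_le B -> order_ge (A `&` B) -> order_le (A `|` B).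
Proof.
rewrite /order_le /order_ge; move: (order_of_submod lam A B).
case: (lam A) => [a|] //; case: (lam B) => [b|] //.
by case: (lam (A `|` B)) => [c|] //; case: (lam (A `&` B)) => [d|] //=; lia.
Qed.

Lemma uncross_ge A B :
  order_le B -> order_ge (A `|` B) -> order_ge (A `&` B) -> order_ge A.
Proof.
rewrite /order_le /order_ge; move: (order_of_submod lam A B).
case: (lam A) => [a|] //; case: (lam B) => [b|] //.
by case: (lam (A `|` B)) => [c|] //; case: (lam (A `&` B)) => [d|] //=; lia.
Qed.

(** Limit-closedness, read backwards: were all members of the chain of order
    at most [K - 1], their union would be, too. *)
Lemma order_ge_bigcup (C : set (set E)) :
  C !=set0 -> total_on C (fun A B => A `<=` B) ->
  order_ge (\bigcup_(A in C) A) -> exists2 A, C A & order_ge A.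
Proof.
move=> C0 Ctot; apply: contraPP => nC.
have lt A : C A -> ~~ order_ge A.
  by move=> CA; apply/negP => geA; apply: nC; exists A.
have [A0 CA0] := C0.
have K0 : 0 < K.
  have := lt _ CA0; rewrite /order_ge; case: (lam A0) => //= n.
  by rewrite -ltnNge; apply: leq_ltn_trans.
have /(order_of_limit C0 Ctot) : forall A, C A -> enat_le (lam A) (Some K.-1).
  move=> A /lt; rewrite /order_ge; case: (lam A) => //= n.
  by rewrite -ltnNge; lia.
by rewrite /order_ge; case: (lam _) => //= n; lia.
Qed.

End Uncrossing.

(** * Cyclic orders and their linear cuts *)

Definition strict_total (I : Type) (R : I -> I -> Prop) : Prop :=
  [/\ forall x, ~ R x x,
      forall x y z, R x y -> R y z -> R x z
    & forall x y, x <> y -> R x y \/ R y x].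

Section LinearCuts.
Variables (I : Type).
Implicit Types (R : I -> I -> Prop) (J : set I) (c : cyclic_order I).

Definition convex R J : Prop :=
  forall x y z, J x -> J z -> R x y -> R y z -> J y.

Definition initial R J : Prop := forall x y, J y -> R x y -> J x.

(** What an interval of a cyclic order looks like after cutting the circle. *)
Definition is_arc R J : Prop := convex R J \/ convex R (~` J).

(** The cyclic order obtained by bending a line into a circle. *)
Definition around R x y z : Prop :=
  R x y /\ R y z \/ R y z /\ R z x \/ R z x /\ R x y.

Lemma strict_total_asym R : strict_total R -> forall x y, R x y -> ~ R y x.
Proof. by case=> irr tr _ x y xy /(tr _ _ _ xy); exact: irr. Qed.

Lemma around_rot R x y z : around R x y z -> around R y z x.
Proof. rewrite /around; tauto. Qed.

Lemma around_asym R : strict_total R ->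
  forall x y z, around R x y z -> ~ around R z y x.
Proof.
move=> tot x y z; rewrite /around.
have := strict_total_asym tot; move=> as_.
by have := @as_ x y; have := @as_ y z; have := @as_ z x; tauto.
Qed.

Lemma around_trans R : strict_total R ->
  forall x y z w, around R x y z -> around R x z w -> around R x y w.
Proof.
move=> tot x y z w; have as_ := strict_total_asym tot; have [ir tr _] := tot.
rewrite /around; have := tr x y z; have := tr x z w; have := tr w x y.
have := tr y z w; have := tr z w x; have := tr w x z.
have := tr y z x; have := tr z x y; have := tr x y w; have := tr y w x.
have := @as_ x y; have := @as_ y z; have := @as_ z x; have := @as_ w x.
have := @as_ z w; have := @as_ y w; tauto.
Qed.

Lemma around_total R : strict_total R -> forall x y z,
  x <> y -> y <> z -> x <> z -> around R x y z \/ around R z y x.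
Proof.
move=> [_ _ tot] x y z /tot xy /tot yz /tot xz; rewrite /around; tauto.
Qed.

Definition cyclic_of_linear R (tot : strict_total R) : cyclic_order I :=
  CyclicOrder (@around_rot R) (around_asym tot) (around_trans tot)
              (around_total tot).

Definition cuts c R : Prop :=
  strict_total R /\ forall x y z, c x y z <-> around R x y z.

(** If neither [J] nor its complement is convex, four points alternate between
    [J] and its complement, and then neither of the two segments between suitable
    points of [J] stays inside [J]. *)
Lemma interval_arc c R : cuts c R -> forall J, is_interval c J <-> is_arc R J.
Proof.
move=> [tot cE] J; have as_ := strict_total_asym tot.
have [ir tr tt] := tot.
split=> [intJ|].
- apply: contrapT => /not_orP[/existsNP[x /existsNP[y /existsNP[z nJ]]]].
  move=> /existsNP[x' /existsNP[y' /existsNP[z' nJ']]].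
  move: nJ => /not_implyP[Jx /not_implyP[Jz /not_implyP[xy /not_implyP[yz Jy]]]].
  move: nJ' => /not_implyP[Jx' /not_implyP[Jz' /not_implyP[xy' /not_implyP[yz' /contrapT Jy']]]].
  have nxz : x <> z by move=> e; subst z; exact: (as_ _ _ xy).
  (* everything outside [x, z] is in J *)
  have out w : c z w x -> J w.
    have [H|H] := intJ x z Jx Jz nxz; last exact: H.
    by case: Jy; apply: H; apply/cE; left.
  have lt_x' : R x x'.
    have [//|x'x] : R x x' \/ R x' x.
      by apply: tt => e; subst x'.
    by case: Jx'; apply: out; apply/cE; right; left; split=> //; apply: tr yz.
  have lt_z' : R z' z.
    have [//|zz'] : R z' z \/ R z z'.
      by apply: tt => e; subst z'.
    by case: Jz'; apply: out; apply/cE; right; right; split=> //; apply: tr yz.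
  have nyz' : y' <> z by move=> e; subst z; exact: (as_ _ _ lt_z').
  have [/(_ z') H|/(_ x') H] := intJ y' z Jy' Jz nyz'.
  + by apply: Jz'; apply: H; apply/cE; left.
  + apply: Jx'; apply: H; apply/cE; right; left; split=> //.
    exact: tr yz' lt_z'.
- case=> conv x z Jx Jz nxz.
  + have [xz|zx] := tt _ _ nxz; [left|right] => w /cE[[h1 h2]|[[h1 h2]|[h1 h2]]].
    * exact: conv h1 h2.
    * by case: (as_ _ _ xz).
    * by case: (as_ _ _ xz).
    * exact: conv h1 h2.
    * by case: (as_ _ _ zx).
    * by case: (as_ _ _ zx).
  + have key a b : J a -> J b -> R a b ->
        strictly_between c a b `<=` J \/ strictly_between c b a `<=` J.
      move=> Ja Jb ab; have [|/existsNP[y /not_implyP[/cE[[h1 h2]|[[h1 h2]|[h1 h2]]] Jy]]] :=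
        EM (strictly_between c a b `<=` J); first by left.
      * right=> w /cE[[h3 h4]|[[h3 h4]|[h3 h4]]]; apply: contrapT => Jw.
        - by case: (as_ _ _ ab); apply: tr h4.
        - by case: (conv w a y Jw Jy).
        - by case: (conv y b w Jy Jw).
      * by case: (as_ _ _ ab).
      * by case: (as_ _ _ ab).
    have [xz|zx] := tt _ _ nxz; first exact: key.
    by have [|] := key z x Jz Jx zx; [right|left].
Qed.

(** Cut just before [o], so that [o] becomes the least element. *)
Lemma cuts_at c (o : I) :
  exists2 R, cuts c R & forall x, x <> o -> R o x.
Proof.
have rot := @cyc_rot _ c; have as_ := @cyc_asym _ c.
have tr := @cyc_trans _ c; have tt := @cyc_total _ c.
have irr3 x y : ~ c x y x by move=> h; exact: (as_ _ _ _ h h).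
have irr2 x y : ~ c x x y by move=> /rot /irr3.
have irr1 x y : ~ c x y y by move=> /rot /irr2.
pose R x y := (x = o /\ y <> o) \/ c o x y.
have Rtot : strict_total R.
  split.
  - by move=> x [[? //]|/irr1].
  - move=> x y z [[-> yo]|xy] [[yo' zo]|yz] //.
    + by left; split=> // zo; subst z; exact: (irr3 _ _ yz).
    + by subst y; case: (irr3 _ _ xy).
    + by right; apply: tr xy yz.
  - move=> x y xy; have [xo|xo] := EM (x = o); first by
      left; left; split=> // yo; apply: xy; rewrite xo yo.
    have [->|yo] := EM (y = o); first by right; left.
    have [|/rot /rot] := tt o x y (nesym xo) xy (nesym yo); first by left; right.
    by right; right.
have RE x y z : R x y -> R y z -> c x y z.
  move=> [[-> yo]|xy] [[yo' zo]|yz] //.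
  - by subst y; case: (irr3 _ _ xy).
  - exact: rot _ _ _ (rot _ _ _ (tr _ _ _ _ (rot _ _ _ yz) (rot _ _ _ (rot _ _ _ xy)))).
have arE x y z : around R x y z -> c x y z.
  by case=> [[h1 h2]|[[h1 h2]|[h1 h2]]];
    [exact: RE | exact: rot _ _ _ (rot _ _ _ (RE _ _ _ h1 h2))
    | exact: rot _ _ _ (RE _ _ _ h1 h2)].
exists R; last by move=> x xo; left.
split=> // x y z; split=> [cxyz|]; last exact: arE.
have xy : x <> y by move=> e; subst y; exact: (irr2 _ _ cxyz).
have yz : y <> z by move=> e; subst z; exact: (irr1 _ _ cxyz).
have xz : x <> z by move=> e; subst z; exact: (irr3 _ _ cxyz).
have [//|/arE] := around_total Rtot xy yz xz.
by move=> h; case: (as_ _ _ _ cxyz).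
Qed.

Lemma reverse_strict_total R : strict_total R -> strict_total (fun x y => R y x).
Proof.
move=> [ir tr tt]; split=> //.
- by move=> x y z yx zy; apply: tr yx.
- by move=> x y /tt[]; [right|left].
Qed.

Lemma reverse_convex R J : convex (fun x y => R y x) J <-> convex R J.
Proof. by split=> conv x y z Jx Jz h1 h2; apply: (conv z y x). Qed.

(** Moving an initial segment of a cut to its other end cuts the same cyclic
    order elsewhere. *)
Definition rotate R (U : set I) (x y : I) : Prop :=
  (~ U x /\ U y) \/ (R x y /\ (U x <-> U y)).

Lemma rotate_cuts c R (U : set I) :
  initial R U -> cuts c R -> cuts c (rotate R U).
Proof.
move=> Uini [tot cE]; have as_ := strict_total_asym tot; have [ir tr tt] := tot.
have UR x y : U x -> ~ U y -> R x y.
  move=> Ux Uy; have [|//|yx] := tt x y; first by move=> e; subst y.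
  by case: Uy; apply: Uini yx.
split; first split.
- by move=> x; rewrite /rotate; have := ir x; tauto.
- move=> x y z; rewrite /rotate; have := @tr x y z.
  have [Ux|Ux] := EM (U x); have [Uy|Uy] := EM (U y);
    have [Uz|Uz] := EM (U z); tauto.
- move=> x y /tt; rewrite /rotate.
  have [Ux|Ux] := EM (U x); have [Uy|Uy] := EM (U y); tauto.
- move=> x y z; rewrite cE /around /rotate.
  have [Ux|Ux] := EM (U x); have [Uy|Uy] := EM (U y);
    have [Uz|Uz] := EM (U z); split.
  all: try (have Rxy := UR x y ltac:(done) ltac:(done)).
  all: try (have Ryx := UR y x ltac:(done) ltac:(done)).
  all: try (have Ryz := UR y z ltac:(done) ltac:(done)).
  all: try (have Rzy := UR z y ltac:(done) ltac:(done)).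
  all: try (have Rxz := UR x z ltac:(done) ltac:(done)).
  all: try (have Rzx := UR z x ltac:(done) ltac:(done)).
  all: have := @as_ x y; have := @as_ y z; have := @as_ z x;
       have := @tr x y z; have := @tr y z x; have := @tr z x y.
  all: tauto.
Qed.

End LinearCuts.

Lemma initial_convex (I : Type) (R : I -> I -> Prop) J :
  initial R J -> convex R J.
Proof. by move=> ini x y z _ Jz _ yz; apply: ini yz. Qed.

Lemma initial_setC_convex (I : Type) (R : I -> I -> Prop) J :
  initial R J -> convex R (~` J).
Proof. by move=> ini x y z nJx _ xy _ Jy; apply: nJx; apply: ini xy. Qed.

Lemma convexI (I : Type) (R : I -> I -> Prop) J J' :
  convex R J -> convex R J' -> convex R (J `&` J').
Proof.
move=> cJ cJ' x y z [Jx J'x] [Jz J'z] xy yz.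
by split; [apply: cJ xy yz | apply: cJ' xy yz].
Qed.

Lemma initial_nested (I : Type) (R : I -> I -> Prop) (D D' : set I) :
  strict_total R -> initial R D -> initial R D' -> D `<=` D' \/ D' `<=` D.
Proof.
move=> [_ _ tot] iD iD'; have [|/existsNP[x /not_implyP[Dx D'x]]] := EM (D `<=` D').
  by left.
right=> y D'y; have [|xy|yx] := tot x y; first by move=> e; subst y.
  by case: D'x; apply: iD' xy.
exact: iD Dx yx.
Qed.

Lemma cyclic_of_linear_arc (T : Type) (R : T -> T -> Prop) (tot : strict_total R) J :
  is_interval (cyclic_of_linear tot) J <-> is_arc R J.
Proof. exact: interval_arc. Qed.

Lemma arc_preimage (T T' : Type) (R : T -> T -> Prop) (R' : T' -> T' -> Prop)
    (g : T' -> T) J :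
  (forall x y, R' x y -> R (g x) (g y) \/ g x = g y) ->
  is_arc R J -> is_arc R' (g @^-1` J).
Proof.
move=> mono; have conv J' : convex R J' -> convex R' (g @^-1` J').
  move=> cJ x y z /= Jx Jz /mono[xy|<- //] /mono[yz|-> //].
  exact: (cJ (g x) (g y) (g z)).
by case=> /conv; [left | right].
Qed.

(** Unlike [cuts], this does not fix the direction in which the circle is read,
    so the line may be reversed to suit the argument. *)
Definition linearizes (I : Type) (c : cyclic_order I) (R : I -> I -> Prop) :=
  strict_total R /\ forall J, is_interval c J <-> is_arc R J.

Lemma cuts_linearizes I (c : cyclic_order I) R : cuts c R -> linearizes c R.
Proof. by move=> cutR; split; [case: cutR | exact: interval_arc]. Qed.

Lemma linearizes_reverse I (c : cyclic_order I) R :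
  linearizes c R -> linearizes c (fun x y => R y x).
Proof.
move=> [tot arcE]; split; first exact: reverse_strict_total.
by move=> J; rewrite arcE /is_arc (reverse_convex R J) (reverse_convex R (~` J)).
Qed.

Lemma not_above_initial I (R : I -> I -> Prop) x :
  strict_total R -> initial R [set y | ~ R x y].
Proof. by move=> [_ tr _] a b nxb ab xa; apply: nxb; apply: tr ab. Qed.

(** A position counts the sets of the nested sequence that a point lies outside
    of. *)
Lemma position_in_nested (I : Type) (D : nat -> set I) (n : nat) :
  (forall i, D i `<=` D i.+1) ->
  exists pos : I -> nat, forall x,
    pos x <= n /\ forall i, i < n -> D i x <-> pos x <= i.
Proof.
move=> nest; have mono i j : i <= j -> D i `<=` D j.
  move=> /subnK <-; elim: (j - i) => [//|m IH].
  by rewrite addSn; apply: subset_trans IH (nest _).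
pose p x i := `[<D i x>].
exists (fun x => find (p x) (iota 0 n)) => x; split.
  by have := find_size (p x) (iota 0 n); rewrite size_iota.
move=> i lt_in; split=> [Dix|le_i].
- rewrite leqNgt; apply/negP => /(before_find 0).
  by rewrite nth_iota // add0n => /asboolP; apply.
- have : has (p x) (iota 0 n) by rewrite has_find size_iota (leq_ltn_trans le_i).
  move=> /(nth_find 0); rewrite nth_iota ?add0n; last exact: leq_ltn_trans lt_in.
  by move=> /asboolP; apply: mono.
Qed.

(** Up to a shift by one, the map counts the chosen points that are at most a given
    point; it is injective on the chosen points, hence onto. *)
Lemma monotone_onto_ord (T : Type) (R : T -> T -> Prop) (n : nat)
    (e : 'I_n.+1 -> T) :
  strict_total R -> injective e ->
  exists q : T -> 'I_n.+1,
    (forall x y, R x y -> q x <= q y) /\ forall i, exists x, q x = i.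
Proof.
move=> [ir tr tt] e_inj.
pose below_ x := [set j : 'I_n.+1 | `[< ~ R x (e j) >]]%SET.
pose q x : 'I_n.+1 := inord #|below_ x|.-1.
have qE x : q x = #|below_ x|.-1 :> nat.
  rewrite inordK //; have := max_card (mem (below_ x)); rewrite card_ord.
  by case: #|_|.
have sub x y : R x y -> below_ x \subset below_ y.
  move=> xy; apply/fintype.subsetP => j; rewrite !finset.in_set => /asboolP nxj.
  apply/asboolP => yj; apply: nxj; apply: tr xy yj.
have mono x y : R x y -> q x <= q y.
  by move=> /sub/subset_leq_card; rewrite !qE; lia.
have lt i j : R (e i) (e j) -> q (e i) < q (e j).
  move=> ij; rewrite !qE.
  have : 0 < #|below_ (e i)|.
    by apply/card_gt0P; exists i; rewrite !finset.in_set; apply/asboolP; exact: ir.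
  suff : #|below_ (e i)| < #|below_ (e j)| by lia.
  apply/proper_card/properP; split; first exact: sub.
  exists j; first by rewrite !finset.in_set; apply/asboolP; exact: ir.
  by rewrite !finset.in_set; apply/negP => /asboolP; apply.
have qe_inj : injective (q \o e).
  move=> i j /= eq_q; apply: e_inj; apply: contrapT => /tt[/lt|/lt];
    by rewrite eq_q ltnn.
exists q; split=> // i; have /codomP[j ->] := injF_onto qe_inj i.
by exists (e j).
Qed.

Lemma ltn_ord_total (n : nat) : strict_total (fun i j : 'I_n => i < j).
Proof.
split.
- by move=> i; rewrite ltnn.
- by move=> i j l; exact: ltn_trans.
- by move=> i j ne; case: (ltngtP i j) => [||/val_inj//]; auto.
Qed.

(** * Pseudoflowers as maps *)

Section PetalOf.
Variables (E : Type) (lam : connectivity E) (k : nat).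
Implicit Types Phi Psi : pseudoflower lam k.

Lemma in_some_petal Phi (e : E) : exists i : petal_index Phi, petal i e.
Proof.
have [cov _ _] := petal_partition Phi.
have : [set: E] e by [].
by rewrite -cov => -[i _ ie]; exists i.
Qed.

Definition petal_of Phi (e : E) : petal_index Phi :=
  projT1 (cid (in_some_petal Phi e)).

Lemma petal_ofP Phi (i : petal_index Phi) e : petal i e <-> petal_of Phi e = i.
Proof.
rewrite /petal_of; case: cid => j /= je; split=> [ie|<- //].
have [_ triv _] := petal_partition Phi.
by apply: triv => //; exists e.
Qed.

Lemma petal_of_surj Phi (i : petal_index Phi) : exists e, petal_of Phi e = i.
Proof.
have [_ _ /(_ i I)[e ie]] := petal_partition Phi.
by exists e; apply/petal_ofP.
Qed.

Lemma petal_unionE Phi (J : set (petal_index Phi)) :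
  petal_union J = petal_of Phi @^-1` J.
Proof.
apply/seteqP; split=> [e [i Ji /petal_ofP ie]|e Je].
  by rewrite /= ie.
by exists (petal_of Phi e) => //; apply/petal_ofP.
Qed.

(** A pseudoflower amounts to a map from the ground set onto a
    cyclically ordered set such that preimages of intervals have small order. *)
Section OfMap.
Variables (T : Type) (c : cyclic_order T) (f : E -> T).
Hypothesis f_surj : forall i, exists e, f e = i.
Hypothesis f_le : forall J, is_interval c J -> order_le lam k.-1 (f @^-1` J).

Lemma partition_of_map :
  partition [set: T] (fun i => f @^-1` [set i]) [set: E].
Proof.
split.
- by apply/seteqP; split=> // e _; exists (f e).
- by move=> i j _ _ [e [/= <- <-]].
- by move=> i _; have [e fe] := f_surj i; exists e.
Qed.

Lemma interval_of_map (J : set T) : is_interval c J ->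
  enat_le (lam (\bigcup_(i in J) f @^-1` [set i])) (Some k.-1).
Proof.
move=> /f_le; congr (is_true (enat_le (lam _) _)).
by apply/seteqP; split=> [e Je|e [i Ji /= ->] //]; exists (f e).
Qed.

Definition pseudoflower_of_map : pseudoflower lam k :=
  Pseudoflower partition_of_map interval_of_map.

Lemma petal_union_of_map (J : set T) :
  petal_union (Phi := pseudoflower_of_map) J = f @^-1` J.
Proof.
by apply/seteqP; split=> [e [i Ji /= ->] //|e Je]; exists (f e).
Qed.

End OfMap.

End PetalOf.

(** * Profiles *)

Section Profile.
Variables (E : Type) (lam : connectivity E) (k : nat).
Hypothesis k_gt0 : 1 <= k.
Variables (P : set (set E)) (P_profile : is_profile lam k P).
Implicit Types R S : set E.

Lemma small_setsE S : small_sets lam k S <-> order_le lam k.-1 S.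
Proof.
rewrite /small_sets /= /enat_lt /order_le; case: (lam S) => [n|] //=.
by rewrite -ltnNge -[in X in X <-> _](prednK k_gt0) ltnS.
Qed.

Lemma profile_order_le S : P S -> order_le lam k.-1 S.
Proof. by case: P_profile => + _ _ _ => /[apply] /small_setsE. Qed.

Lemma profile_dich S : order_le lam k.-1 S -> P S \/ P (~` S).
Proof.
by case: P_profile => _ dich _ _ /small_setsE/dich; tauto.
Qed.

Lemma profile_excl S : P S -> ~ P (~` S).
Proof.
move=> PS; case: P_profile => _ dich _ _.
by move/profile_order_le/small_setsE/dich: (PS); tauto.
Qed.

Lemma profile_sub R S : order_le lam k.-1 R -> R `<=` S -> P S -> P R.
Proof.
move=> Rle RS PS; have [<- //|nRS] := EM (S = R).
case: P_profile => _ _ /(_ R S) + _; apply=> //.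
- exact/small_setsE.
- exact/small_setsE/profile_order_le.
- by split=> // SR; apply: nRS; apply/seteqP.
Qed.

Lemma profile_cover R S : P R -> P S -> ~ P (~` (R `|` S)).
Proof. by case: P_profile => _ _ _; apply. Qed.

Lemma profile_cup R S : order_le lam k.-1 (R `|` S) ->
  P R -> P S -> P (R `|` S).
Proof. by move=> /profile_dich[//|] + PR PS => /(profile_cover PR PS). Qed.

(** Otherwise the empty set, which is contained in the ground set, would also be
    in [P]. *)
Lemma profile_neqT : ~ P setT.
Proof.
move=> PT; have le0 : order_le lam k.-1 set0 by rewrite -setCT order_leC profile_order_le.
by apply: (profile_excl PT); rewrite setCT; apply: profile_sub PT.
Qed.

End Profile.

Section DistinguishedProfiles.
Variables (E : Type) (lam : connectivity E) (k : nat).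
Hypothesis k_gt0 : 1 <= k.
Implicit Types P Q : set (set E).

Lemma distinguishesC (S : set E) P Q :
  distinguishes S P Q -> distinguishes S Q P.
Proof. by rewrite /distinguishes; tauto. Qed.

Lemma distinguishes_setC (S : set E) P Q :
  distinguishes S P Q -> distinguishes (~` S) P Q.
Proof. by rewrite /distinguishes setCK; tauto. Qed.

Lemma undistinguished P Q (S : set E) :
  is_profile lam k P -> is_profile lam k Q -> order_le lam k.-1 S ->
  ~ distinguishes S P Q -> P S <-> Q S.
Proof.
move=> hP hQ Sle; have := profile_dich k_gt0 hP Sle; have := profile_dich k_gt0 hQ Sle.
have := profile_excl k_gt0 hP (S := S); have := profile_excl k_gt0 hQ (S := S).
by rewrite /distinguishes; tauto.
Qed.

(** A set of order less than [k - 1] belongs to the common truncation or to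
    neither profile.  All lower bounds on orders come from here or from the
    daisy. *)
Lemma distinguishing_ge P Q S :
  truncation lam k P = truncation lam k Q -> P S -> ~ Q S -> order_ge lam k.-1 S.
Proof.
move=> eqT PS QS; apply: contrapT => nge; apply: QS.
have : truncation lam k P S by split=> //; exact/negP.
by rewrite eqT => -[].
Qed.

End DistinguishedProfiles.

Section Crossing.
Variables (E : Type) (lam : connectivity E) (k : nat).
Hypothesis k_gt0 : 1 <= k.
Variables P Q : set (set E).
Hypotheses (hP : is_profile lam k P) (hQ : is_profile lam k Q).
Hypothesis eqT : truncation lam k P = truncation lam k Q.
Implicit Types S X : set E.

(** [S] avoids both profiles and [X] separates them, so the union of [S] and [X]
    still separates them and has order at least [k - 1]; the opposite corner is
    then cheap. *)
Lemma small_cross_le S X : P S -> Q S -> P (~` X) -> Q X ->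
  order_le lam k.-1 (S `&` X).
Proof.
move=> PS QS PX QX; apply: uncross_cap; [exact: profile_order_le PS | exact: profile_order_le QX |].
have [le|//] := order_le_or_ge lam k.-1 (S `|` X).
apply: (distinguishing_ge (esym eqT)); first exact: profile_cup le QS QX.
have leX : order_le lam k.-1 X by exact: profile_order_le QX.
move=> /(profile_sub k_gt0 hP leX (@subsetUr _ _ _)) PX'.
exact: (profile_excl k_gt0 hP PX').
Qed.

(** [P] lives in both [S] and [X], hence in their intersection, while [Q] lives
    outside [X]. *)
Lemma big_cross_ge S X : P (~` S) -> P (~` X) -> Q X ->
  order_ge lam k.-1 (S `&` X).
Proof.
move=> PS PX QX; have [le|//] := order_le_or_ge lam k.-1 (S `&` X).
apply: (distinguishing_ge (esym eqT)).
  by apply: (profile_sub k_gt0 hQ le _ QX); exact: subIsetr.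
by rewrite -[_ `&` _]setCK setCI; exact: (profile_cover hP PS PX).
Qed.

End Crossing.

(** * Profiles along a linear cut *)

Section AlongCut.
Variables (E : Type) (lam : connectivity E) (k : nat).
Hypothesis k_gt0 : 1 <= k.
Variables (I : Type) (R : I -> I -> Prop) (f : E -> I).
Hypothesis tot : strict_total R.
Hypothesis f_le : forall J, convex R J -> order_le lam k.-1 (f @^-1` J).
Implicit Types P Q : set (set E).

Lemma arc_le J : is_arc R J -> order_le lam k.-1 (f @^-1` J).
Proof. by case=> [|/f_le]; [exact: f_le | rewrite preimage_setC order_leC]. Qed.

(** Profiles contain the small sides of separations: [P] lives to the left of the
    cut at the end of [D], and [Q] to the right of it. *)
Definition before P Q : Prop :=
  exists2 D, initial R D & P (~` (f @^-1` D)) /\ Q (f @^-1` D).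

(** A convex set is the difference of two initial segments, and two profiles that
    agree on both of these agree on the difference. *)
Lemma distinguishes_before P Q J :
  is_profile lam k P -> is_profile lam k Q ->
  is_arc R J -> distinguishes (f @^-1` J) P Q -> before P Q \/ before Q P.
Proof.
move=> hP hQ arcJ dJ; have [ir tr tt] := tot.
wlog cJ : J arcJ dJ / convex R J.
  move=> gen; case: (arcJ) => cJ; first exact: gen dJ cJ.
  by apply: (gen (~` J)) => //; [left | exact: distinguishes_setC].
pose D1 := [set y | exists2 x, J x & ~ R x y].
pose D0 := D1 `&` ~` J.
have iD1 : initial R D1.
  by move=> x y [z Jz nzy] xy; exists z => // zx; apply: nzy; apply: tr xy.
have iD0 : initial R D0.
  move=> x y [[z Jz nzy] nJy] xy; split; first by apply: iD1 xy; exists z.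
  move=> Jx; apply: nJy; have [e|nyz] := EM (y = z); first by subst z.
  by apply: (cJ x y z) => //; case: (tt _ _ nyz).
have le1 : order_le lam k.-1 (f @^-1` D1) by exact: f_le (initial_convex iD1).
have le0 : order_le lam k.-1 (f @^-1` D0) by exact: f_le (initial_convex iD0).
apply: contrapT => nb.
have nd D : initial R D -> order_le lam k.-1 (f @^-1` D) ->
    P (f @^-1` D) <-> Q (f @^-1` D).
  move=> iD leD; apply: (undistinguished k_gt0 hP hQ leD).
  by move=> [[PD QD]|[QD PD]]; apply: nb; [right|left]; exists D.
have {nd}[eq1 eq0] := (nd _ iD1 le1, nd _ iD0 le0).
have JD1 : J `<=` D1 by move=> x Jx; exists x => //; exact: ir.
have leJ := f_le cJ.
(* B lives in J, that is, inside D1 and outside D0; so does A by agreement,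
   although A contains J *)
have key A B : is_profile lam k A -> is_profile lam k B ->
    (A (f @^-1` D1) <-> B (f @^-1` D1)) -> (A (f @^-1` D0) <-> B (f @^-1` D0)) ->
    A (f @^-1` J) -> B (~` (f @^-1` J)) -> False.
  move=> hA hB e1 e0 AJ BJ.
  have nB1 : ~ B (f @^-1` D1).
    move=> /(profile_sub k_gt0 hB leJ (preimage_subset JD1)) BJ'.
    exact: (profile_excl k_gt0 hB BJ').
  have B0 : B (f @^-1` D0).
    by apply: (profile_sub k_gt0 hB le0) BJ => e [].
  have [//|nA1] := profile_dich k_gt0 hA le1; first by move/e1.
  apply: (profile_cover hA AJ (iffRL e0 B0)).
  rewrite (_ : _ `|` _ = f @^-1` D1) //; apply/seteqP; split=> e /=.
    by case=> [/JD1//|[]].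
  by have [] := EM (J (f e)); [left | right].
by case: dJ => -[]; [exact: key | apply: key => //; exact: iff_sym].
Qed.

Lemma before_subset P D D' : is_profile lam k P ->
  initial R D -> initial R D' ->
  P (~` (f @^-1` D')) -> P (f @^-1` D) -> D `<=` D'.
Proof.
move=> hP iD iD' nPD' PD; have [//|D'D] := initial_nested tot iD iD'.
have leD' : order_le lam k.-1 (f @^-1` D') by exact: f_le (initial_convex iD').
have PD' := profile_sub k_gt0 hP leD' (preimage_subset D'D) PD.
by case: (profile_excl k_gt0 hP PD').
Qed.

(** On a line, the first two of the four profiles are either one of the two given
    pairs or one member of each.  In the first case the segment between the first
    and the last cut splits both pairs, in the other case the middle cut does. *)
Lemma separate_sorted_pairs P Q P' Q' :
  is_profile lam k P -> is_profile lam k Q ->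
  is_profile lam k P' -> is_profile lam k Q' ->
  before P Q -> before P' Q' -> before P P' -> before Q P' \/ before P' Q ->
  exists2 J, convex R J &
    distinguishes (f @^-1` J) P Q /\ distinguishes (f @^-1` J) P' Q'.
Proof.
move=> hP hQ hP' hQ' [D iD [PD QD]] [D' iD' [P'D' Q'D']] PP' [QP'|P'Q].
- have [D2 iD2 [QD2 P'D2]] := QP'.
  have DD2 : D `<=` D2 by apply: (before_subset hQ).
  have D2D' : D2 `<=` D' by apply: (before_subset hP').
  pose J := D' `&` ~` D.
  have cJ : convex R J.
    by apply: convexI; [exact: initial_convex | exact: initial_setC_convex].
  have [[leJ leD] leD2] := (f_le cJ, f_le (initial_convex iD), f_le (initial_convex iD2)).
  have JD : f @^-1` J `|` f @^-1` D = f @^-1` D'.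
    apply/seteqP; split=> e /=; first by case=> [[]//|/DD2/D2D'].
    by move=> D'e; have [De|nDe] := EM (D (f e)); [right | left].
  have le' : order_le lam k.-1 (~` (f @^-1` D')).
    by rewrite order_leC; exact: f_le (initial_convex iD').
  have PJ : P (f @^-1` J) by apply: (profile_sub k_gt0 hP leJ _ PD) => e [].
  have Q'J : Q' (f @^-1` J) by apply: (profile_sub k_gt0 hQ' leJ _ Q'D') => e [].
  exists J => //; split; [left | right]; split=> //.
  + have [QJ|//] := profile_dich k_gt0 hQ leJ.
    case: (profile_cover hQ QJ QD); rewrite JD.
    by apply: (profile_sub k_gt0 hQ le' _ QD2) => e nD' /D2D'.
  + have [P'J|//] := profile_dich k_gt0 hP' leJ.
    have P'D : P' (f @^-1` D).
      exact: (profile_sub k_gt0 hP' leD (preimage_subset DD2) P'D2).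
    by have := profile_cover hP' P'J P'D; rewrite JD.
- have [D1 iD1 [PD1 P'D1]] := PP'; have [D2 iD2 [P'D2 QD2]] := P'Q.
  (* the cuts D2 and D' lie between P' and Q, and between P' and Q'; the smaller
     one lies before both Q and Q' *)
  pose D3 := D2 `&` D'.
  have iD3 : initial R D3.
    by move=> x y [D2y D'y] xy; split; [apply: iD2 xy | apply: iD' xy].
  have le3 := f_le (initial_convex iD3).
  have P'D3 : P' (~` (f @^-1` D3)).
    have [s|s] := initial_nested tot iD2 iD'.
    - by rewrite /D3 setIidl.
    - by rewrite /D3 setIidr.
  have D13 : D1 `<=` D3 by apply: (before_subset hP').
  exists D3; first exact: initial_convex.
  split; right; split.
  + by apply: (profile_sub k_gt0 hQ le3 _ QD2) => e [].
  + apply: (profile_sub k_gt0 hP _ _ PD1); first by rewrite order_leC.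
    by move=> e nD1 /D13.
  + by apply: (profile_sub k_gt0 hQ' le3 _ Q'D') => e [].
  + exact: P'D3.
Qed.

Lemma separate_pairs P Q P' Q' :
  is_profile lam k P -> is_profile lam k Q ->
  is_profile lam k P' -> is_profile lam k Q' ->
  before P Q \/ before Q P -> before P' Q' \/ before Q' P' ->
  before P P' \/ before P' P -> before P Q' \/ before Q' P ->
  before Q P' \/ before P' Q -> before Q Q' \/ before Q' Q ->
  exists2 J, convex R J &
    distinguishes (f @^-1` J) P Q /\ distinguishes (f @^-1` J) P' Q'.
Proof.
wlog PQ : P Q / before P Q.
  move=> gen hP hQ hP' hQ' [] b; first exact: gen (or_introl b).
  move=> b' h1 h2 h3 h4; have [J cJ [d d']] := gen Q P b hQ hP hP' hQ' (or_introl b) b' h3 h4 h1 h2.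
  by exists J => //; split=> //; exact: distinguishesC.
wlog PQ' : P' Q' / before P' Q'.
  move=> gen hP hQ hP' hQ' b []; first by move=> b'; exact: gen (or_introl b').
  move=> b' h1 h2 h3 h4.
  have [J cJ [d d']] := gen Q' P' b' hP hQ hQ' hP' b (or_introl b') h2 h1 h4 h3.
  by exists J => //; split=> //; exact: distinguishesC.
move=> hP hQ hP' hQ' _ _ [PP'|P'P] h1 h2 h3; first exact: separate_sorted_pairs.
have [J cJ [d d']] := separate_sorted_pairs hP' hQ' hP hQ PQ' PQ P'P (iffLR (or_comm _ _) h1).
by exists J.
Qed.

End AlongCut.

(** * Where a profile lives in a pseudoflower *)

Section Location.
Variables (E : Type) (lam : connectivity E) (k : nat).
Hypothesis k_gt0 : 1 <= k.
Variable Phi : pseudoflower lam k.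
Local Notation I := (petal_index Phi).
Local Notation c := (index_cyc Phi).
Local Notation f := (petal_of Phi).

Lemma interval_le (J : set I) : is_interval c J -> order_le lam k.-1 (f @^-1` J).
Proof. by move=> /petal_interval; rewrite -/(petal_union J) petal_unionE. Qed.

Lemma convex_le R (J : set I) : linearizes c R -> convex R J ->
  order_le lam k.-1 (f @^-1` J).
Proof. by case=> _ arcE cJ; apply/interval_le/arcE; left. Qed.

Lemma petalE (i : I) : petal i = f @^-1` [set i].
Proof. by apply/seteqP; split=> e /petal_ofP. Qed.

(** Cut the circle anywhere and let [U] be the set of points up to which the
    line is small for [P].  When all petals are small, [P] lives at the cut
    where [U] ends, on one of its two sides; rotating the line moves that cut to
    the end. *)
Lemma profile_location P (o : I) : is_profile lam k P ->
  (exists i : I, P (~` petal i)) \/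
  exists2 R, linearizes c R & forall x, P (f @^-1` [set y | ~ R x y]).
Proof.
move=> hP; have [|/forallNP noi] := EM (exists i : I, P (~` petal i)).
  by left.
right; have single i : P (f @^-1` [set i]).
  have /(profile_dich k_gt0 hP)[//|] : order_le lam k.-1 (f @^-1` [set i]).
    by apply: interval_le => x z -> ->.
  by rewrite -petalE => /noi.
have [R cutR _] := cuts_at c o.
have linR := cuts_linearizes cutR; have [tot arcE] := linR.
have [ir tr tt] := tot; have as_ := strict_total_asym tot.
pose upto x := [set y | ~ R x y].
have upto_ini x : initial R (upto x) by exact: not_above_initial.
have [U UE] : exists U : set I, forall x, U x <-> P (f @^-1` upto x).
  by exists [set x | P (f @^-1` upto x)].
have iniU : initial R U.
  move=> x y /UE Py xy; apply/UE.
  have le := convex_le linR (initial_convex (upto_ini x)).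
  apply: (profile_sub k_gt0 hP le _ Py) => e /= nxe ye.
  by apply: nxe; apply: tr ye.
have cutR' := rotate_cuts iniU cutR; have linR' := cuts_linearizes cutR'.
have UR x y : U x -> ~ U y -> R x y.
  move=> Ux Uy; have [|//|yx] := tt x y; first by move=> e; subst y.
  by case: Uy; apply: iniU yx.
have leU := convex_le linR (initial_convex iniU).
have [PU|PnU] := profile_dich k_gt0 hP leU.
- (* [P] approaches the cut from beyond [U], which the rotated line has at its
     beginning; so the line is reversed *)
  exists (fun x y => rotate R U y x); first exact: linearizes_reverse.
  move=> x; rewrite /rotate; have [Ux|nUx] := EM (U x).
    have linR'' := linearizes_reverse linR'.
    have le' := convex_le linR'' (initial_convex (not_above_initial (x := x) linR''.1)).
    by apply: (profile_sub k_gt0 hP le' _ PU) => e; rewrite /= /rotate; have := EM (U (f e)); tauto.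
  pose W := [set y | ~ U y /\ R y x].
  have cW : convex R W.
    move=> a b d [Ua ax] [Ud dx] ab bd; split; last exact: tr dx.
    by move=> Ub; apply: Ua; apply: iniU ab.
  have -> : [set y | ~ (~ U y /\ U x \/ R y x /\ (U y <-> U x))] = ~` W.
    by apply/seteqP; split=> y; rewrite /W /=; tauto.
  have [PW|] := profile_dich k_gt0 hP (convex_le linR cW); last by [].
  case: (nUx); apply/UE.
  have PR : P (f @^-1` [set y | R y x]).
    have eqW : f @^-1` [set y | R y x] = f @^-1` U `|` f @^-1` W.
      apply/seteqP; split=> e; rewrite /W /=; last first.
        by case=> [Ue|[_]]; first exact: UR.
      by have := EM (U (f e)); tauto.
    rewrite eqW; apply: (profile_cup k_gt0 hP) => //; rewrite -eqW.
    by apply: (convex_le linR); apply: initial_convex => a b /= bx /tr; apply.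
  have eqx : f @^-1` upto x = f @^-1` [set y | R y x] `|` f @^-1` [set x].
    apply/seteqP; split=> e; rewrite /upto /=.
      by have [->|/tt] := EM (f e = x); [right | tauto].
    by case=> [/as_|->] //; exact: ir.
  rewrite eqx; apply: (profile_cup k_gt0 hP) => //; rewrite -eqx.
  exact: convex_le linR (initial_convex (upto_ini x)).
- (* [P] approaches the cut from inside [U] *)
  exists (rotate R U) => // x; rewrite /rotate; have [Ux|nUx] := EM (U x); last first.
    have le' := convex_le linR' (initial_convex (not_above_initial (x := x) linR'.1)).
    by apply: (profile_sub k_gt0 hP le' _ PnU) => e; rewrite /= /rotate; tauto.
  have -> : f @^-1` [set y | ~ (~ U x /\ U y \/ R x y /\ (U x <-> U y))] =
      f @^-1` upto x `|` ~` (f @^-1` U).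
    by apply/seteqP; split=> e; rewrite /upto /=; have := EM (U (f e)); tauto.
  apply: (profile_cup k_gt0 hP) => //; last exact/UE.
  pose Z := U `&` [set y | R x y].
  rewrite (_ : _ `|` _ = ~` (f @^-1` Z)).
    rewrite order_leC; apply: (convex_le linR) => a b d [_ xa] [Ud _] ab bd.
    by split; [apply: iniU bd | apply: tr ab].
  by apply/seteqP; split=> e; rewrite /upto /Z /=; have := EM (U (f e)); tauto.
Qed.

End Location.

(** * Crossed pieces next to each other *)

Section Alternation.
Variables (E : Type) (lam : connectivity E) (K : nat).
Local Notation le := (order_le lam K).
Local Notation ge := (order_ge lam K).

(** Uncrossing glues the part of [B] on either side of [X] to [A] and to [D];
    the two sets so obtained meet in the union of [A] and [D]. *)
Lemma uncross_alternate (A B D X : set E) :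
  (forall e, A e -> ~ D e) -> le A -> le D ->
  le ((A `|` B `|` D) `&` X) -> le ((A `|` B `|` D) `&` ~` X) ->
  ge (A `&` X) -> ge (A `&` ~` X) -> ge (D `&` X) -> ge (D `&` ~` X) ->
  ge (A `|` B `|` D) -> le (A `|` D).
Proof.
move=> AD leA leD leX leX' geAX geAX' geDX geDX' geABD.
have half Y : le ((A `|` B `|` D) `&` Y) -> ge (A `&` Y) -> ge (D `&` Y) ->
    le (A `|` B `&` Y `|` D).
  move=> leY geAY geDY.
  have le1 : le (A `|` (B `|` D) `&` Y).
    rewrite (_ : _ `|` _ = A `|` (A `|` B `|` D) `&` Y).
      apply: uncross_cup => //; rewrite (_ : _ `&` _ = A `&` Y) //.
      by apply/seteqP; split=> e /=; tauto.
    by apply/seteqP; split=> e /=; tauto.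
  rewrite (_ : _ `|` _ = (A `|` (B `|` D) `&` Y) `|` D).
    apply: uncross_cup => //; rewrite (_ : _ `&` _ = D `&` Y) //.
    by apply/seteqP; split=> e /=; have := AD e; tauto.
  by apply/seteqP; split=> e /=; tauto.
rewrite (_ : A `|` D = (A `|` B `&` X `|` D) `&` (A `|` B `&` ~` X `|` D)).
  apply: uncross_cap; [exact: half | exact: half |].
  rewrite (_ : _ `|` _ = A `|` B `|` D) //.
  by apply/seteqP; split=> e /=; have := EM (X e); tauto.
by apply/seteqP; split=> e /=; tauto.
Qed.

Variable pos : E -> nat.
Hypothesis pos_lt : forall e, pos e < 8.

(** Unions of classes of a partition into eight parts are written as lists, so
    that equalities between such unions are decided by computation. *)
Definition classes (s : seq nat) : set E := [set e | pos e \in s].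

Local Notation agree u v := (all (fun i => (i \in u) == v i) (iota 0 8)).

Lemma agreeP (u : seq nat) (v : nat -> bool) :
  agree u v -> forall e, (pos e \in u) = v (pos e).
Proof. by move=> /allP h e; apply/eqP/h; rewrite mem_iota /= pos_lt. Qed.

Lemma classesC s u : agree u (fun i => i \notin s) ->
  classes u = ~` classes s.
Proof.
move=> /agreeP h; apply/seteqP; split=> e; rewrite /classes /= h.
  by move=> /negP.
by move/negP.
Qed.

Lemma classesI s t u : agree u (fun i => (i \in s) && (i \in t)) ->
  classes u = classes s `&` classes t.
Proof.
by move=> /agreeP h; apply/seteqP; split=> e; rewrite /classes /= h => /andP.
Qed.

Lemma classesU s t u : agree u (fun i => (i \in s) || (i \in t)) ->
  classes u = classes s `|` classes t.
Proof.
by move=> /agreeP h; apply/seteqP; split=> e; rewrite /classes /= h => /orP.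
Qed.

Lemma classes_uncross_cap s t (u v : seq nat) :
  le (classes s) -> le (classes t) -> ge (classes v) ->
  agree u (fun i => (i \in s) && (i \in t)) ->
  agree v (fun i => (i \in s) || (i \in t)) -> le (classes u).
Proof.
move=> les let_ gev /classesI-> /classesU euv; apply: uncross_cap => //.
by rewrite -euv.
Qed.

Lemma classes_uncross_cup s t (u v : seq nat) :
  le (classes s) -> le (classes t) -> ge (classes v) ->
  agree u (fun i => (i \in s) || (i \in t)) ->
  agree v (fun i => (i \in s) && (i \in t)) -> le (classes u).
Proof.
move=> les let_ gev /classesU-> /classesI euv; apply: uncross_cup => //.
by rewrite -euv.
Qed.

(** Think of the eight classes as consecutive intervals of a circle, with 7
    followed by 0, and of 1, 2, 3 as petals of a daisy inside whose fourth petal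
    all the others lie.  If two non-adjacent pieces of that petal together have
    small order, so do the opposite petals 1 and 3: pass from the pair 4, 6
    to its complement, shrink that to the pair 1, 5, and from there to 1, 3. *)
Lemma classes_spread :
  le (classes [:: 1; 2; 3]) -> le (classes [:: 2; 3; 4]) ->
  le (classes [:: 3; 4; 5]) -> le (classes [:: 4; 5; 6]) ->
  le (classes [:: 1; 2; 3; 4; 5]) ->
  ge (classes [:: 4]) -> ge (classes [:: 5]) -> ge (classes [:: 6]) ->
  ge (classes [:: 0; 4; 5; 6; 7]) ->
  le (classes [:: 4; 6]) -> le (classes [:: 1; 3]).
Proof.
move=> le123 le234 le345 le456 le12345 ge4 ge5 ge6 geD le46.
have ge067 : ge (classes [:: 0; 6; 7]).
  apply: (uncross_ge le456); first by rewrite -(@classesU _ _ [:: 0; 4; 5; 6; 7]).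
  by rewrite -(@classesI _ _ [:: 6]).
have le0157 : le (classes [:: 0; 1; 5; 7]).
  apply: (@classes_uncross_cap [:: 0; 1; 2; 3; 5; 7] [:: 0; 1; 5; 6; 7]
    _ [:: 0; 1; 2; 3; 5; 6; 7]) => //.
  - by rewrite (@classesC [:: 4; 6]) // order_leC.
  - by rewrite (@classesC [:: 2; 3; 4]) // order_leC.
  - by rewrite (@classesC [:: 4]) // order_geC.
have le15 : le (classes [:: 1; 5]).
  apply: (@classes_uncross_cap [:: 0; 1; 5; 7] [:: 1; 2; 3; 4; 5]
    _ [:: 0; 1; 2; 3; 4; 5; 7]) => //.
  by rewrite (@classesC [:: 6]) // order_geC.
have le1345 : le (classes [:: 1; 3; 4; 5]).
  exact: (@classes_uncross_cup [:: 1; 5] [:: 3; 4; 5] _ [:: 5]).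
apply: (@classes_uncross_cap [:: 1; 3; 4; 5] [:: 1; 2; 3] _ [:: 1; 2; 3; 4; 5]) => //.
by rewrite (@classesC [:: 0; 6; 7]) // order_geC.
Qed.

End Alternation.

(** * Quarterings *)

Section Quartering.
Variables (I : Type) (R : I -> I -> Prop) (le ge : set I -> Prop).
Implicit Types A B C D : set I.

Definition quarter A B : Prop :=
  [/\ A !=set0, ge A, is_arc R A & is_arc R (A `|` B)].

(** What a four-petal daisy leaves on the index set of a refinement. *)
Definition quartering A B C D : Prop :=
  [/\ forall x, (A x \/ B x \/ C x \/ D x) /\
        ~ (A x /\ B x) /\ ~ (A x /\ C x) /\ ~ (A x /\ D x) /\
        ~ (B x /\ C x) /\ ~ (B x /\ D x) /\ ~ (C x /\ D x),
      quarter A B /\ quarter B C, quarter C D /\ quarter D A,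
      ~ le (A `|` C) & ~ le (B `|` D)].

Lemma quartering_rot A B C D : quartering A B C D -> quartering B C D A.
Proof.
move=> [part [qA qB] [qC qD] nAC nBD]; split=> //; last by rewrite setUC.
by move=> x; have := part x; tauto.
Qed.

Lemma quartering_rev A B C D : quartering A B C D -> quartering A D C B.
Proof.
move=> [part [[A0 gA aA aAB] [B0 gB aB aBC]] [[C0 gC aC aCD] [D0 gD aD aDA]] nAC nBD].
split=> //; first by move=> x; have := part x; tauto.
- by split; split=> //; rewrite setUC.
- by split; split=> //; rewrite setUC.
- by rewrite setUC.
Qed.

Hypothesis tot : strict_total R.
Hypothesis nomax : forall x, exists y, R x y.

Definition tail (a : I) : set I := [set x | R a x].

(** On a line without last element an arc contains or avoids a whole tail. *)
Lemma arc_tail (a0 : I) J : is_arc R J ->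
  (exists a, tail a `<=` J) \/ (exists a, tail a `<=` ~` J).
Proof.
have conv J' : convex R J' ->
    (exists a, tail a `<=` J') \/ (exists a, tail a `<=` ~` J').
  move=> cJ; have [|/forallNP nt] := EM (exists a, tail a `<=` ~` J').
    by right.
  have above a : exists2 z, R a z & J' z.
    have /existsNP[z /not_implyP[az /contrapT Jz]] := nt a.
    by exists z.
  left; have [a _ Ja] := above a0; exists a => x ax.
  by have [z xz Jz] := above x; apply: cJ Ja Jz ax xz.
by case=> /conv //; rewrite setCK => -[]; [right | left].
Qed.

Lemma bounded_arc_convex (a : I) J : is_arc R J -> tail a `<=` ~` J -> convex R J.
Proof.
have [ir tr tt] := tot => -[//|cJ] aJ x y z Jx Jz xy yz.
have [w aw] := nomax a.
have zw : R z w.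
  have [->//|/tt[za|az]] := EM (z = a); first exact: tr za aw.
  by case: (aJ z az).
by apply: contrapT => Jy; apply: (cJ y z w) => //; apply: aJ.
Qed.

Definition below J J' : Prop := forall x y, J x -> J' y -> R x y.

Lemma convex_disjoint_below J J' : convex R J -> convex R J' ->
  (forall x, ~ (J x /\ J' x)) -> below J J' \/ below J' J.
Proof.
have [ir tr tt] := tot => cJ cJ' dis.
have [|/existsNP[x /existsNP[y /not_implyP[Jx /not_implyP[J'y nxy]]]]] :=
  EM (below J J'); first by left.
right=> y' x' J'y' Jx'; apply: contrapT => ny'x'.
have ne a b : J a -> J' b -> a <> b.
  by move=> Ja J'b e; apply: (dis a); rewrite {2}e.
have yx : R y x by have [] := tt _ _ (ne _ _ Jx J'y).
have x'y' : R x' y' by have [] := tt _ _ (ne _ _ Jx' J'y').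
have [x'y|yx'] := tt _ _ (ne _ _ Jx' J'y).
- by apply: (dis y); split=> //; apply: cJ x'y yx.
- by apply: (dis x'); split=> //; apply: cJ' yx' x'y'.
Qed.

(** Exactly one part contains a tail; it can be turned to the front.  The
    others are then convex, and as [C] is adjacent to [B] and to [D] it lies between
    them, so that a reflection puts all three in increasing order. *)
Lemma quartering_normal A B C D (a0 : I) : quartering A B C D ->
  exists A' B' C' D', quartering A' B' C' D' /\
    exists2 a, tail a `<=` A' & below B' C' /\ below C' D'.
Proof.
have [ir tr tt] := tot => q.
have as_ := strict_total_asym tot.
wlog [a aA] : A B C D q / exists a, tail a `<=` A.
  move=> gen; have q2 := quartering_rot q; have q3 := quartering_rot q2.
  have q4 := quartering_rot q3.
  have arcs : [/\ is_arc R A, is_arc R B, is_arc R C & is_arc R D].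
    by case: q => _ [[_ _ ? _] [_ _ ? _]] [[_ _ ? _] [_ _ ? _]] _ _.
  case: arcs => /(arc_tail a0)[/(gen _ _ _ _ q)//|[a1 h1]].
  move=> /(arc_tail a0)[/(gen _ _ _ _ q2)//|[a2 h2]].
  move=> /(arc_tail a0)[/(gen _ _ _ _ q3)//|[a3 h3]].
  move=> /(arc_tail a0)[/(gen _ _ _ _ q4)//|[a4 h4]].
  have up a b : exists c, forall x, R c x -> R a x /\ R b x.
    have [->|/tt[ab|ba]] := EM (a = b).
    - by exists b.
    - by exists b => x bx; split=> //; apply: tr bx.
    - by exists a => x bx; split=> //; apply: tr bx.
  have [b1 u1] := up a1 a2; have [b2 u2] := up a3 a4; have [b3 u3] := up b1 b2.
  have [x /u3[/u1[x1 x2] /u2[x3 x4]]] := nomax b3.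
  have [/(_ x) part _ _ _ _] := q.
  have := h1 _ x1; have := h2 _ x2; have := h3 _ x3; have := h4 _ x4.
  by rewrite /=; tauto.
case: (q) => part [[A0 gA aA' aAB] [B0 gB aB aBC]]
  [[C0 gC aC aCD] [D0 gD aD aDA]] nAC nBD.
have conv J : is_arc R J -> (forall x, ~ (A x /\ J x)) -> convex R J.
  move=> aJ dis; apply: (bounded_arc_convex (a := a)) => // x /aA Ax Jx.
  exact: (dis x).
have cB : convex R B by apply: conv => // x; have := part x; tauto.
have cC : convex R C by apply: conv => // x; have := part x; tauto.
have cD : convex R D by apply: conv => // x; have := part x; tauto.
have cBC : convex R (B `|` C) by apply: conv => // x; have := part x; rewrite /=; tauto.
have cCD : convex R (C `|` D) by apply: conv => // x; have := part x; rewrite /=; tauto.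
have cBD : forall x, ~ (B x /\ D x) by move=> x; have := part x; tauto.
have [b Bb] := B0; have [c Cc] := C0; have [d Dd] := D0.
have [BC|CB] : below B C \/ below C B.
  by apply: convex_disjoint_below => // x; have := part x; tauto.
all: have [CD|DC] : below C D \/ below D C;
  try by apply: convex_disjoint_below => // x; have := part x; tauto.
- by exists A, B, C, D; split=> //; exists a.
- have [bd|db] : R b d \/ R d b by apply: tt => e; apply: (cBD b); rewrite {2}e.
  + have [] := cBC b d c (or_introl Bb) (or_intror Cc) bd (DC _ _ Dd Cc).
      by move=> Bd; case: (cBD d).
    by move=> Cd; have := part d; tauto.
  + have [] := cCD d b c (or_intror Dd) (or_introl Cc) db (BC _ _ Bb Cc).
      by move=> Cb; have := part b; tauto.
    by move=> Db; case: (cBD b).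
- have [bd|db] : R b d \/ R d b by apply: tt => e; apply: (cBD b); rewrite {2}e.
  + have [] := cCD c b d (or_introl Cc) (or_intror Dd) (CB _ _ Cc Bb) bd.
      by move=> Cb; have := part b; tauto.
    by move=> Db; case: (cBD b).
  + have [] := cBC c d b (or_intror Cc) (or_introl Bb) (CD _ _ Cc Dd) db.
      by move=> Bd; case: (cBD d).
    by move=> Cd; have := part d; tauto.
- by exists A, D, C, B; split; [exact: quartering_rev | exists a].
Qed.

End Quartering.

(** * Profiles at a cut *)

(** [P] and [Q] live at the end of a line, [P1] somewhere else, and [X] separates
    [P] from [Q]. *)

Section AtCut.
Variables (E : Type) (lam : connectivity E) (k : nat).
Hypothesis k_gt0 : 1 <= k.
Variables (I : Type) (R : I -> I -> Prop) (f : E -> I).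
Hypothesis tot : strict_total R.
Hypothesis f_le : forall J, convex R J -> order_le lam k.-1 (f @^-1` J).
Variables P Q P1 : set (set E).
Hypotheses (hP : is_profile lam k P) (hQ : is_profile lam k Q)
  (hP1 : is_profile lam k P1).
Hypotheses (PQ : truncation lam k P = truncation lam k Q)
  (PP1 : truncation lam k P = truncation lam k P1).
Hypotheses (P_end : forall x, P (f @^-1` [set y | ~ R x y]))
  (Q_end : forall x, Q (f @^-1` [set y | ~ R x y])).
Variable b1 : I.
Hypothesis P1_b1 : ~ P1 (f @^-1` [set y | R y b1]).
Variable X : set E.
Hypotheses (PX : P (~` X)) (QX : Q X).

Local Notation ge := (order_ge lam k.-1).
Local Notation le := (order_le lam k.-1).
Let tr : forall x y z, R x y -> R y z -> R x z.
Proof. by case: tot. Qed.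
Let tt : forall x y, x <> y -> R x y \/ R y x.
Proof. by case: tot. Qed.

Lemma no_last x : exists y, R x y.
Proof.
apply: contrapT => /forallNP nx; apply: (profile_neqT k_gt0 hP).
by have := P_end x; congr (P _); apply/seteqP; split=> // e _; exact: nx.
Qed.

Lemma before_initial x : initial R [set y | R y x].
Proof. by move=> a b bx ab; exact: tr ab bx. Qed.

Lemma initial_le D : initial R D -> le (f @^-1` D).
Proof. by move=> /initial_convex; exact: f_le. Qed.

Lemma P_proper D x : convex R D -> (forall y, D y -> ~ R x y) ->
  P (f @^-1` D) /\ Q (f @^-1` D).
Proof.
move=> cD Dx; have leD := f_le cD; split.
- by apply: (profile_sub k_gt0 hP leD _ (P_end x)) => e /Dx.
- by apply: (profile_sub k_gt0 hQ leD _ (Q_end x)) => e /Dx.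
Qed.

Definition upto (F : set I) (b : I) : set I := F `&` [set y | R y b].

Section Tail.
Variable F : set I.
Hypotheses (F_tail : initial R (~` F)) (F0 : F !=set0).

Lemma tail_up x y : F x -> ~ R y x -> F y.
Proof.
move=> Fx nyx; have [<- //|/tt[xy|//]] := EM (x = y).
by apply: contrapT => nFy; apply: (F_tail nFy xy).
Qed.

Lemma tail_convex : convex R F.
Proof. by have := initial_setC_convex F_tail; rewrite setCK. Qed.

Lemma upto_convex b : convex R (upto F b).
Proof.
exact: (convexI tail_convex (initial_convex (@before_initial b))).
Qed.

Lemma P_tail : P (f @^-1` (~` F)) /\ Q (f @^-1` (~` F)).
Proof.
have [x Fx] := F0; apply: (P_proper (x := x)); first exact: initial_convex.
by move=> y nFy xy; apply: (F_tail nFy xy).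
Qed.

Lemma P_upto b : P (f @^-1` upto F b) /\ Q (f @^-1` upto F b).
Proof.
apply: (P_proper (x := b)); first exact: upto_convex.
by move=> y [_ yb]; exact: strict_total_asym yb.
Qed.

(** The parts [upto F b] exhaust [F], so limit-closedness applies. *)
Lemma eventually_ge (Y : set E) : ge (f @^-1` F `&` Y) ->
  exists2 b0, F b0 & forall b, ~ R b b0 -> ge (f @^-1` upto F b `&` Y).
Proof.
move=> geF; apply: contrapT => nb.
have bad b0 : F b0 -> exists2 b, ~ R b b0 & ~ ge (f @^-1` upto F b `&` Y).
  move=> Fb0; apply: contrapT => nb0; apply: nb; exists b0 => // b bb0.
  by apply: contrapT => nge; apply: nb0; exists b.
pose C := [set A | exists2 b, ~ ge (f @^-1` upto F b `&` Y)
                            & A = f @^-1` upto F b `&` Y].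
have C0 : C !=set0.
  by have [x /bad[b _ nge]] := F0; exists (f @^-1` upto F b `&` Y); exists b.
have Ctot : total_on C (fun A B => A `<=` B).
  move=> _ _ [b _ ->] [b' _ ->].
  have sub c c' : ~ R c' c -> upto F c `<=` upto F c'.
    move=> ncc' x [Fx xc]; split=> //=.
    have [<- //|/tt[cc'|//]] := EM (c = c').
    exact: tr xc cc'.
  have [bb'|nbb'] := EM (R b b').
    left; apply: setSI; apply: preimage_subset; apply: sub.
    exact: strict_total_asym bb'.
  by right; apply: setSI; apply: preimage_subset; apply: sub.
have geC : ge (\bigcup_(A in C) A).
  rewrite (_ : \bigcup_(A in C) A = f @^-1` F `&` Y) //; apply/seteqP; split.
    by move=> e [_ [b _ ->] [[]]].
  move=> e [Fe Ye]; have [y ey] := no_last (f e).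
  have Fy : F y by apply: (tail_up Fe); exact: strict_total_asym ey.
  have [b yb nge] := bad y Fy; exists (f @^-1` upto F b `&` Y); first by exists b.
  split=> //; split=> //=.
  have [<- //|/tt[yb'|//]] := EM (y = b).
  exact: tr ey yb'.
by have [_ [b nge ->]] := order_ge_bigcup C0 Ctot geC.
Qed.

(** Both [X] and its complement cut [F] in a set separating [P] from [Q].  For [F]
    itself the third profile [P1] is needed, which distinguishes either [F] or
    all long enough parts of it from [P]. *)
Lemma eventually_crossed :
  exists2 b0, F b0 & forall b, ~ R b b0 ->
    [/\ ge (f @^-1` upto F b), ge (f @^-1` upto F b `&` X)
      & ge (f @^-1` upto F b `&` ~` X)].
Proof.
have [Pt Qt] := P_tail.
have [b2 Fb2 geX] : exists2 b0, F b0 &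
    forall b, ~ R b b0 -> ge (f @^-1` upto F b `&` X).
  by apply: eventually_ge; exact: (big_cross_ge k_gt0 hP hQ PQ).
have [b3 Fb3 geX'] : exists2 b0, F b0 &
    forall b, ~ R b b0 -> ge (f @^-1` upto F b `&` ~` X).
  apply: eventually_ge; apply: (big_cross_ge k_gt0 hQ hP (esym PQ)) => //.
  by rewrite setCK.
have [b4 Fb4 geF] : exists2 b0, F b0 &
    forall b, ~ R b b0 -> ge (f @^-1` upto F b).
  have [P1t|nP1t] := EM (P1 (f @^-1` (~` F))).
    (* [P1] lives beyond the start of [F] but not at the end, so every long
       enough part separates it from [P] *)
    have [b4 Fb4 b14] : exists2 b, F b & ~ R b b1.
      have [Fb1|nFb1] := EM (F b1).
        by exists b1 => //; case: tot.
      by have [x Fx] := F0; exists x => // xb1; apply: (F_tail nFb1 xb1).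
    exists b4 => // b b4b; apply: (distinguishing_ge PP1); first exact: (P_upto b).1.
    move=> P1u; apply: P1_b1.
    have eqU : f @^-1` (~` F `|` [set y | R y b]) =
        f @^-1` (~` F) `|` f @^-1` upto F b.
      by apply/seteqP; split=> e; rewrite /upto /=; have := EM (F (f e)); tauto.
    have leU : le (f @^-1` (~` F `|` [set y | R y b])).
      apply: initial_le => x y [nFy|yb] xy; first by left; apply: F_tail xy.
      by right; apply: tr xy yb.
    have P1U : P1 (f @^-1` (~` F `|` [set y | R y b])).
      by rewrite eqU in leU *; exact: profile_cup leU P1t P1u.
    apply: (profile_sub k_gt0 hP1 _ _ P1U).
      exact: initial_le (@before_initial b1).
    move=> e /= eb1; right.
    have eb4 : R (f e) b4.
      by have [<- //|/tt[|//]] := EM (b1 = b4); exact: tr.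
    by have [<- //|/tt[|//]] := EM (b4 = b); exact: tr.
  have geF : ge (f @^-1` F).
    by rewrite -order_geC; exact: distinguishing_ge PP1 Pt nP1t.
  have [] := eventually_ge (Y := setT); first by rewrite setIT.
  by move=> b0 Fb0 h; exists b0 => // b /h; rewrite setIT.
have max u v : F u -> F v -> exists2 m, F m &
    forall b, ~ R b m -> ~ R b u /\ ~ R b v.
  move=> Fu Fv; have [uv|nuv] := EM (R u v); [exists v | exists u] => // b bm.
    by split=> // bu; apply: bm; apply: tr bu uv.
  split=> // bv; apply: bm; have [<- //|] := EM (v = u).
  by move=> /tt[vu|//]; apply: tr bv vu.
have [m Fm h] := max _ _ Fb2 Fb3; have [m' Fm' h'] := max _ _ Fb4 Fm.
exists m' => // b /h'[b4b /h[b2b b3b]].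
by split; [exact: geF | exact: geX | exact: geX'].
Qed.

End Tail.

(** The part [A] contains a tail [F] of the line.  Three consecutive pieces of [F],
    long enough to be crossed by [X], play the classes 4, 5, 6 of
    [classes_spread], and [B], [C], [D] the classes 1, 2, 3. *)
Lemma no_quartering A B C D :
  ~ quartering R (fun J => le (f @^-1` J)) (fun J => ge (f @^-1` J)) A B C D.
Proof.
have as_ := strict_total_asym tot; have [ir _ _] := tot.
move=> /(quartering_normal tot no_last b1).
move=> {A B C D}[A [B [C [D [[part [qA qB] [qC qD] _ nBD] [a aA [BC CD]]]]]]].
have [[c Cc] _ _ _] := qC; have [_ _ _ /= _] := qC.
have [[d Dd] _ _ _] := qD; have [_ geA arcA _] := qA.
have BD x y : B x -> D y -> R x y.
  by move=> Bx Dy; apply: tr (BC _ _ Bx Cc) (CD _ _ Cc Dy).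
have nAE x : ~ A x <-> B x \/ C x \/ D x by have := part x; tauto.
have cT : convex R (~` A).
  apply: (bounded_arc_convex tot no_last (a := a)).
    by case: arcA => cA; [right; rewrite setCK | left].
  by move=> x /aA Ax nAx.
pose F := [set x | forall t, ~ A t -> R t x].
have F_tail : initial R (~` F).
  by move=> x y nFy xy Fx; apply: nFy => t /Fx tx; apply: tr xy.
have [a' aa'] := no_last a.
have F0 : F !=set0.
  exists a' => t nAt; have [e|/tt[//|a't]] := EM (t = a').
    by case: nAt; rewrite e; apply: aA.
  by case: nAt; apply: aA; apply: tr a't.
have [b2 Fb2 ev2] := eventually_crossed F_tail F0.
have tail_from b : initial R (~` [set y | ~ R y b]).
  by move=> x y /contrapT yb xy /(_ (tr xy yb)).
have tail_nonempty b : [set y | ~ R y b] !=set0 by exists b; exact: ir.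
have [b3 b23 ev3] := eventually_crossed (tail_from b2) (tail_nonempty b2).
have [b4 b34 ev4] := eventually_crossed (tail_from b3) (tail_nonempty b3).
have b24 : ~ R b4 b2.
  move=> b42; apply: b34; have [<- //|/tt[b2b3|//]] := EM (b2 = b3).
  exact: tr b42 b2b3.
(* classes 0 and 7 are what remains of [A] before [B] and after the pieces *)
pose S (t : set I) := [set x | forall y, t y -> R x y].
pose N i := nth [set: I] [:: S (~` A); S (C `|` D); S D; ~` F;
  [set y | R y b2]; [set y | R y b3]; [set y | R y b4]] i.
have N_initial i : i < 7 -> initial R (N i).
  case: i => [|[|[|[|[|[|[|i]]]]]]] lt7 x y //; rewrite /N /= /S.
  1-3: by move=> yt xy t /yt; exact: tr xy.
  1: by move=> nFy xy; exact: F_tail xy.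
  1-3: by move=> yb xy; exact: tr xy yb.
have N_nested i : N i `<=` N i.+1.
  case: i => [|[|[|[|[|[|[|i]]]]]]] x //; rewrite /N /= /S /=.
  - by move=> xt t CDt; apply: xt; apply/nAE; right.
  - by move=> xt t Dt; apply: xt; right.
  - move=> xD Fx; have nAd : ~ A d by apply/nAE; right; right.
    exact: (as_ _ _ (xD d Dd) (Fx d nAd)).
  - move=> nFx; apply: contrapT => nxb; apply: nFx.
    exact: (tail_up F_tail Fb2).
  - move=> xb; have [<- //|/tt[b2b3|//]] := EM (b2 = b3); exact: tr xb b2b3.
  - move=> xb; have [<- //|/tt[b3b4|//]] := EM (b3 = b4); exact: tr xb b3b4.
have [pos posP] := position_in_nested 7 N_nested.
have pos_le i x : i < 7 -> N i x <-> pos x <= i by have [_] := posP x; apply.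
have pos_mono x y : R x y -> pos x <= pos y.
  move=> xy; have [lt7|] := ltnP (pos y) 7.
    by apply/pos_le => //; apply: N_initial xy => //; apply/pos_le.
  by apply: leq_trans; have [] := posP x.
have pos_lt e : pos (f e) < 8 by rewrite ltnS; have [] := posP (f e).
have posB x : B x -> pos x = 1.
  move=> Bx; have nAx : ~ A x by apply/nAE; left.
  apply/eqP; rewrite eqn_leq; apply/andP; split.
    by apply/pos_le => // y [Cy|Dy]; [exact: BC | exact: BD].
  by rewrite ltnNge; apply/negP => /(pos_le 0 x isT) /(_ x nAx); exact: ir.
have posC x : C x -> pos x = 2.
  move=> Cx; apply/eqP; rewrite eqn_leq; apply/andP; split.
    by apply/pos_le => // y Dy; exact: CD.
  rewrite ltnNge; apply/negP => /(pos_le 1 x isT) h.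
  by apply: (ir x); apply: h; left.
have posD x : D x -> pos x = 3.
  move=> Dx; have nAx : ~ A x by apply/nAE; right; right.
  apply/eqP; rewrite eqn_leq; apply/andP; split.
    by apply/pos_le => // /(_ x nAx); exact: ir.
  by rewrite ltnNge; apply/negP => /(pos_le 2 x isT) /(_ x Dx); exact: ir.
have posA x : A x -> pos x \in [:: 0; 4; 5; 6; 7].
  move=> Ax; have [Fx|nFx] := EM (F x).
    have : ~ pos x <= 3 by move=> /(pos_le 3 x isT); apply.
    by rewrite !inE; have [] := posP x; lia.
  have : pos x <= 0.
    apply/pos_le => // y nAy; apply: contrapT => nxy; apply: nFx => t nAt.
    apply: contrapT => ntx; have yx : R y x.
      by have [e|/tt[]//] := EM (y = x); case: nAy; rewrite e.
    have xt : R x t by have [e|/tt[]//] := EM (x = t); case: nAt; rewrite -e.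
    exact: (cT y x t nAy nAt yx xt Ax).
  by rewrite leqn0 => /eqP->.
pose cl := classes (pos \o f).
have clE s J : (forall x, pos x \in s <-> J x) -> cl s = f @^-1` J.
  by move=> h; apply/seteqP; split=> e /h.
have le_iota i n : le (cl (iota i n)).
  rewrite (clE _ [set x | pos x \in iota i n]) //; apply: f_le => x y z /=.
  by rewrite !mem_iota => + + /pos_mono + /pos_mono; lia.
have eA : cl [:: 0; 4; 5; 6; 7] = f @^-1` A.
  by apply: clE => x; split=> [|/posA//]; apply: contraPP => /nAE[/posB|[/posC|/posD]] ->.
have eBD : cl [:: 1; 3] = f @^-1` (B `|` D).
  apply: clE => x; split=> [|[/posB|/posD] -> //].
  have [Ax|/nAE[Bx|[/posC->//|Dx]]] := EM (A x); [|by left|by right].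
  by have := posA x Ax; rewrite !inE; lia.
have gtP i x : i < 7 -> ~ N i x <-> i < pos x.
  by move=> lt7; rewrite (pos_le i x lt7) ltnNge; split=> /negP.
have range i j x (s : seq nat) : i < j -> j < 7 ->
    (pos x \in s) = (i < pos x <= j) -> pos x \in s <-> (~ N i x /\ N j x).
  move=> ij j7 ->; rewrite (gtP i x (ltn_trans ij j7)) (pos_le j x j7).
  by split=> [/andP|/andP].
have e4 : cl [:: 4] = f @^-1` upto F b2.
  apply: clE => x; rewrite (@range 3 4) //; last by rewrite !inE; lia.
  by rewrite /N /= /upto /=; have := EM (F x); tauto.
have e456 : cl [:: 4; 5; 6] = f @^-1` upto F b4.
  apply: clE => x; rewrite (@range 3 6) //; last by rewrite !inE; lia.
  by rewrite /N /= /upto /=; have := EM (F x); tauto.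
have e5 : cl [:: 5] = f @^-1` upto [set y | ~ R y b2] b3.
  by apply: clE => x; rewrite (@range 4 5) //; rewrite !inE; lia.
have e6 : cl [:: 6] = f @^-1` upto [set y | ~ R y b3] b4.
  by apply: clE => x; rewrite (@range 5 6) //; rewrite !inE; lia.
have e456U : cl [:: 4] `|` cl [:: 5] `|` cl [:: 6] = cl [:: 4; 5; 6].
  rewrite /cl (classesU pos_lt (s := [:: 4; 5]) (t := [:: 6]) (u := [:: 4; 5; 6])) //.
  by rewrite (classesU pos_lt (s := [:: 4]) (t := [:: 5]) (u := [:: 4; 5])).
have [ge4 ge4X ge4X'] := ev2 b2 (ir b2); rewrite -e4 in ge4 ge4X ge4X'.
have [ge5 _ _] := ev3 b3 (ir b3); rewrite -e5 in ge5.
have [ge6 ge6X ge6X'] := ev4 b4 (ir b4); rewrite -e6 in ge6 ge6X ge6X'.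
have [ge456 _ _] := ev2 b4 b24; rewrite -e456 in ge456.
have [P456 Q456] := P_upto F_tail b4; rewrite -e456 in P456 Q456.
apply: nBD; rewrite -eBD; apply: (classes_spread pos_lt) => //.
- exact: le_iota 1 3.
- exact: le_iota 2 3.
- exact: le_iota 3 3.
- exact: le_iota 4 3.
- exact: le_iota 1 5.
- by rewrite -/cl eA.
rewrite (classesU pos_lt (s := [:: 4]) (t := [:: 6])) //.
apply: (uncross_alternate (B := cl [:: 5]) (X := X)) => //.
- by move=> e /=; rewrite /classes /= !inE => /eqP->.
- exact: le_iota 4 1.
- exact: le_iota 6 1.
- by rewrite e456U; exact: (small_cross_le k_gt0 hP hQ PQ).
- rewrite e456U; apply: (small_cross_le k_gt0 hQ hP (esym PQ)) => //.
  by rewrite setCK.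
- by rewrite e456U.
Qed.

End AtCut.

(** * Profiles at a petal *)

(** [P] and [Q] live at the petal [i0], which the line has as its last point; [P1]
    lives in the initial segment [D] and [P2] after it, but not at [i0]. *)

Section AtPetal.
Variables (E : Type) (lam : connectivity E) (k : nat).
Hypothesis k_gt0 : 1 <= k.
Variable Phi : pseudoflower lam k.
Local Notation I := (petal_index Phi).
Local Notation f := (petal_of Phi).
Variables (i0 : I) (R : I -> I -> Prop).
Hypotheses (linR : linearizes (index_cyc Phi) R) (i0_last : forall x, x <> i0 -> R x i0).
Variables P Q P1 P2 : set (set E).
Hypotheses (hP : is_profile lam k P) (hQ : is_profile lam k Q)
  (hP1 : is_profile lam k P1) (hP2 : is_profile lam k P2).
Hypotheses (PP1 : truncation lam k P = truncation lam k P1)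
  (PP2 : truncation lam k P = truncation lam k P2).
Hypotheses (P_i0 : P (~` petal i0)) (Q_i0 : Q (~` petal i0)).
Hypothesis PP2_dist : before R f P P2 \/ before R f P2 P.
Variable D : set I.
Hypotheses (D_initial : initial R D) (P1D : P1 (~` (f @^-1` D))) (P2D : P2 (f @^-1` D)).
Variable X : set E.
Hypotheses (PX : P (~` X)) (QX : Q X) (P1X : P1 (~` X)) (P2X : P2 X).

Local Notation ge := (order_ge lam k.-1).
Local Notation le := (order_le lam k.-1).

Let f_le := fun J => @convex_le _ _ _ Phi R J linR.
Let tot : strict_total R := linR.1.
Let as_ := strict_total_asym tot.
Let tr : forall x y z, R x y -> R y z -> R x z.
Proof. by case: tot. Qed.

Lemma initial_avoids_last A D' : is_profile lam k A -> initial R D' ->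
  A (f @^-1` D') -> ~ D' i0.
Proof.
move=> hA iD' AD' Di0; apply: (profile_neqT k_gt0 hA).
rewrite (_ : setT = f @^-1` D') //; apply/seteqP; split=> // e _ /=.
have [->//|/i0_last ei] := EM (f e = i0); exact: iD' Di0 ei.
Qed.

Lemma P_rest A J : is_profile lam k A -> A (~` petal i0) -> convex R J -> ~ J i0 ->
  A (f @^-1` J).
Proof.
move=> hA Ai0 cJ Ji0; apply: (profile_sub k_gt0 hA (f_le cJ) _ Ai0) => e Je.
by rewrite petalE => ei; apply: Ji0; rewrite -ei.
Qed.

Let L2 := ~` D `&` ~` [set i0].

Let cL2 : convex R L2.
Proof.
move=> x y z [nDx xi] [nDz zi] xy yz; split; first by move=> Dy; apply: nDx; exact: D_initial Dy xy.
by move=> e; rewrite /= in e; subst y; apply: (as_ yz); apply: i0_last.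
Qed.

Let Di0 : ~ D i0. Proof. exact: initial_avoids_last hP2 D_initial P2D. Qed.
Let cD : convex R D. Proof. exact: initial_convex. Qed.
Let L2i0 : ~ L2 i0. Proof. by case=> _; apply. Qed.

Lemma P2_i0 : P2 (petal i0).
Proof.
have le_petal : le (petal i0).
  by rewrite petalE; apply: interval_le => x z -> ->.
have [//|P2n] := profile_dich k_gt0 hP2 le_petal.
case: PP2_dist => -[D' iD' [AD' BD']].
- have ni := initial_avoids_last hP2 iD' BD'.
  by case: (profile_excl k_gt0 hP (P_rest hP P_i0 (initial_convex iD') ni)).
- have ni := initial_avoids_last hP iD' BD'.
  by case: (profile_excl k_gt0 hP2 (P_rest hP2 P2n (initial_convex iD') ni)).
Qed.

Lemma P2_L2 : P2 (~` (f @^-1` L2)).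
Proof.
have [P2L|//] := profile_dich k_gt0 hP2 (f_le cL2).
have := profile_cover hP2 P2D P2_i0; rewrite petalE (_ : ~` _ = f @^-1` L2) //.
by apply/seteqP; split=> e; rewrite /L2 /=; tauto.
Qed.

Let ge_D : ge (f @^-1` D).
Proof.
apply: (distinguishing_ge PP1); first exact: P_rest.
by move/(profile_excl k_gt0 hP1).
Qed.

Let ge_L2 : ge (f @^-1` L2).
Proof.
apply: (distinguishing_ge PP2); first exact: P_rest.
by move/(profile_excl k_gt0 hP2); apply; exact: P2_L2.
Qed.

(** The set is [X] with [D] added and [L2] removed.  Neither step increases
    the order, as [P1] lives both in [D] and in [X], and [P2] both in [L2] and
    outside [X]. *)
Lemma le_X_part : le (f @^-1` [set i0] `&` X `|` f @^-1` D).
Proof.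
rewrite (_ : _ `|` _ = (X `|` f @^-1` D) `&` ~` (f @^-1` L2)); last first.
  apply/seteqP; split=> e; rewrite /L2 /=.
    move=> [[-> Xe]|De]; first by split; [left | case].
    by split; [right | case].
  have := EM (D (f e)); have := EM (f e = i0); tauto.
apply: uncross_cap.
- apply: uncross_cup; [exact: profile_order_le QX | exact: f_le cD |].
  exact: (big_cross_ge k_gt0 hP1 hP (esym PP1) P1X P1D (P_rest hP P_i0 cD Di0)).
- by rewrite order_leC; exact: f_le.
- rewrite -order_geC (_ : ~` _ = ~` X `&` f @^-1` L2); last first.
    by apply/seteqP; split=> e; rewrite /L2 /=; have := EM (D (f e)); have := EM (f e = i0); tauto.
  apply: (big_cross_ge k_gt0 hP2 hP (esym PP2)); [by rewrite setCK | exact: P2_L2 |].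
  exact: P_rest.
Qed.

Lemma le_coX_part : le (f @^-1` [set i0] `&` ~` X `|` f @^-1` L2).
Proof.
rewrite -order_leC; move: le_X_part; congr (is_true (order_le _ _ _)).
have nD e : f e = i0 -> ~ D (f e) by move=> ->; exact: Di0.
apply/seteqP; split=> e; rewrite /L2 /=; first by have := nD e; tauto.
have := EM (D (f e)); have := EM (f e = i0); have := EM (X e); tauto.
Qed.

(** The intervals of the refined pseudoflower that separate the halves of [i0]:
    start from the case [A = L2] and grow or shrink [A] by uncrossing with an
    interval of [Phi]. *)
Lemma le_coX_final (A : set I) : ~ A i0 ->
  (forall x y, A x -> R x y -> y <> i0 -> A y) ->
  le (f @^-1` [set i0] `&` ~` X `|` f @^-1` A).
Proof.
move=> Ai0 upA.
have cA : convex R (A `|` [set i0]).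
  move=> x y z Ax _ xy yz; have [e|ni] := EM (y = i0); [by right | left].
  case: Ax => [Ax|e]; first exact: upA xy ni.
  by rewrite /= in e; subst x; case: (as_ xy); exact: i0_last.
have cA' : convex R A.
  move=> x y z Ax Az xy yz; apply: (upA x) => // e; subst y.
  by apply: (as_ yz); apply: i0_last => e; subst z.
have inL2 x : L2 x -> forall y, R x y -> y <> i0 -> L2 y.
  by move=> [nDx _] y xy yi; split=> // Dy; apply: nDx; exact: D_initial Dy xy.
have [AL|LA] : A `<=` L2 \/ L2 `<=` A.
  have [|/existsNP[x /not_implyP[Ax nLx]]] := EM (A `<=` L2); [by left | right].
  move=> y Ly; have [<-//|] := EM (x = y).
  case: tot => _ _ tt /tt[xy|yx]; first by apply: upA xy _ => // e; apply: L2i0; rewrite -e.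
  by case: nLx; apply: inL2 yx _ => // e; apply: Ai0; rewrite -e.
- rewrite (_ : _ `|` _ = (f @^-1` [set i0] `&` ~` X `|` f @^-1` L2) `&`
                         f @^-1` (A `|` [set i0])); last first.
    apply/seteqP; split=> e /=; last first.
      move=> [[|[nDe ne]]]; first by left.
      by case=> [|//]; right.
    by case=> [[ei nX]|Ae]; [split; [left | right] | split; [right; exact: AL | left]].
  apply: uncross_cap; [exact: le_coX_part | exact: f_le |].
  rewrite (_ : _ `|` _ = ~` (f @^-1` D)) ?order_geC //.
  apply/seteqP; split=> e /=.
    by case=> [[[-> _]|[]]|[/AL[]|->]].
  move=> nDe; have [ei|ei] := EM (f e = i0); first by right; right.
  by left; right.
- rewrite (_ : _ `|` _ = (f @^-1` [set i0] `&` ~` X `|` f @^-1` L2) `|` f @^-1` A);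
    last first.
    apply/seteqP; split=> e /=; last by case=> [[|/LA]|]; [left | right | right].
    by case; [left; left | right].
  apply: uncross_cup; [exact: le_coX_part | exact: f_le |].
  rewrite (_ : _ `&` _ = f @^-1` L2) //; apply/seteqP; split=> e /=.
    by case=> [[[-> _]|]].
  by move=> Le; split; [right | exact: LA].
Qed.

(** ** Splitting the petal *)

Definition split_petal (e : E) : option I :=
  if pselect (f e = i0 /\ X e) then None else Some (f e).

(** The part inside [X] becomes the new last petal.  Round the circle it is thus
    followed by [D], with which it has small order by [le_X_part]. *)
Definition after_last (x y : option I) : Prop :=
  match x, y with
  | Some a, Some b => R a b
  | Some _, None => True
  | None, _ => False
  end.

Lemma after_last_total : strict_total after_last.
Proof.
have [ir _ tt] := tot; split.
- by case.
- by move=> [x|] [y|] [z|] //=; exact: tr.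
- move=> [x|] [y|] //= ne; [|by left|by right].
  by apply: tt => e; apply: ne; rewrite e.
Qed.

Lemma split_petal_surj x : exists e, split_petal e = x.
Proof.
rewrite /split_petal; case: x => [i|].
  have [ei|ni] := EM (i = i0); last first.
    have [e fe] := petal_of_surj i; exists e.
    by case: pselect => [[]|]; rewrite fe.
  apply: contrapT => /forallNP none; apply: (profile_excl k_gt0 hQ QX).
  have leX : le (~` X) by rewrite order_leC; exact: profile_order_le QX.
  apply: (profile_sub k_gt0 hQ leX _ Q_i0) => e nXe /petal_ofP fe.
  by apply: (none e); case: pselect => [[]//|]; rewrite fe ei.
apply: contrapT => /forallNP none; apply: (profile_excl k_gt0 hP (S := X)) => //.
apply: (profile_sub k_gt0 hP _ _ P_i0); first exact: profile_order_le QX.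
by move=> e Xe /petal_ofP fe; apply: (none e); case: pselect => // -[].
Qed.

Lemma split_petal_le J : is_interval (cyclic_of_linear after_last_total) J ->
  le (split_petal @^-1` J).
Proof.
move=> /cyclic_of_linear_arc; apply: arc_le => {}J cJ.
pose J0 := [set i | J (Some i)].
have cJ0 : convex R J0 by move=> x y z; exact: (cJ (Some x) (Some y) (Some z)).
have i0N x : J0 x -> J None -> J0 i0.
  move=> Jx JN; have [<-//|/i0_last xi] := EM (x = i0).
  exact: (cJ (Some x) (Some i0) None).
have [JN|nJN] := EM (J None); have [Ji|nJi] := EM (J0 i0).
- rewrite (_ : _ @^-1` _ = f @^-1` J0); first exact: f_le.
  apply/seteqP; split=> e; rewrite /split_petal /=; case: pselect => //=.
  by case=> fe _ _; rewrite fe.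
- rewrite (_ : _ @^-1` _ = ~` (f @^-1` [set i0] `&` ~` X `|` f @^-1` (~` [set i0]))).
    rewrite order_leC; apply: le_coX_final; first by apply.
    by move=> x y _ _.
  apply/seteqP; split=> e; rewrite /split_petal /=; case: pselect => //=.
  + by case=> fe Xe _ [[]|].
  + by move=> _ Je; case: nJi; apply: i0N JN; exact: Je.
  + move=> nfe h; exfalso; apply: h; have [fe|] := EM (f e = i0); last by right.
    by left; split=> // Xe; apply: nfe.
- rewrite (_ : _ @^-1` _ = f @^-1` [set i0] `&` ~` X `|` f @^-1` (J0 `&` ~` [set i0])).
    apply: le_coX_final; first by case=> _; apply.
    move=> x y [Jx xi] xy yi; split=> //; apply: (cJ0 x y i0) => //.
    exact: i0_last.
  apply/seteqP; split=> e; rewrite /split_petal /=; case: pselect => //=.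
  + move=> nfe Je; have [fe|fe] := EM (f e = i0); last by right.
    by left; split=> // Xe; apply: nfe.
  + by case=> fe Xe [[_ /(_ Xe)]|[_ /(_ fe)]].
  + by move=> _ [[-> _]|[]].
- rewrite (_ : _ @^-1` _ = f @^-1` J0); first exact: f_le.
  apply/seteqP; split=> e; rewrite /split_petal /=; case: pselect => //=.
  by case=> fe _; rewrite fe.
Qed.

(** The refinement is strict since both halves of the petal are nonempty. *)
Lemma petal_splits : exists2 Psi : pseudoflower lam k,
  concatenation Phi Psi & ~ concatenation Psi Phi.
Proof.
exists (pseudoflower_of_map split_petal_surj split_petal_le).
  exists (fun x => if x is Some i then i else i0); split.
    move=> x e; rewrite /= /split_petal; case: pselect => [[fe _]|_] <- //=.
      exact/petal_ofP.
    exact/petal_ofP.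
  move=> J /(linR.2) aJ; apply/cyclic_of_linear_arc; apply: arc_preimage aJ.
  move=> [x|] [y|] //=; first by left.
  by move=> _; have [->|/i0_last] := EM (x = i0); [right | left].
move=> [h [sub _]].
have [a fa] := split_petal_surj None; have [b fb] := split_petal_surj (Some i0).
have pet e : f e = i0 -> split_petal e = h i0 by move=> /petal_ofP /sub.
have fa0 : f a = i0 by move: fa; rewrite /split_petal; case: pselect => [[]|].
have fb0 : f b = i0.
  by move: fb; rewrite /split_petal; case: pselect => // _ [].
by move: (pet a fa0) (pet b fb0); rewrite fa fb => <-.
Qed.

End AtPetal.

(** * Quarterings from daisies *)

Section DaisyQuartering.
Variables (E : Type) (lam : connectivity E) (k : nat).
Variables (Phi Delta : pseudoflower lam k).
Hypotheses (daisy : is_daisy Delta) (conc : concatenation Delta Phi).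
Variable R : petal_index Phi -> petal_index Phi -> Prop.
Hypothesis linR : linearizes (index_cyc Phi) R.
Local Notation f := (petal_of Phi).
Local Notation ge := (order_ge lam k.-1).
Local Notation le := (order_le lam k.-1).

Definition ordset (s : seq nat) : set 'I_4 := [set i | nat_of_ord i \in s].

Lemma ordset_nontrivial s : (exists2 i, i < 4 & i \in s) ->
  (exists2 i, i < 4 & i \notin s) -> nontrivial (ordset s).
Proof.
move=> [i i4 si] [j j4 sj]; split=> eqs.
  by have : ordset s (Ordinal i4) by []; rewrite eqs.
have : ordset s (Ordinal j4) by rewrite eqs.
by rewrite /ordset /= (negbTE sj).
Qed.

(** A monotone map from the petals of the daisy onto four points is a
    concatenation; its fibres, pulled back to [Phi], form the quartering. *)
Lemma daisy_quartering : exists A B C D,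
  quartering R (fun J => le (f @^-1` J)) (fun J => ge (f @^-1` J)) A B C D.
Proof.
have [[card4 _] daisyP] := daisy; have [g [g_sub g_int]] := conc.
have [e e_inj] : exists e : 'I_4 -> petal_index Delta, injective e.
  have /card_leP[h] := card4.
  exists (fun i => set_val (h (SigSub (mem_set (I : [set: 'I_4] i))))).
  by move=> i j hij; have [] := injT (val_inj hij).
have [S cutS _] := cuts_at (index_cyc Delta) (e ord0).
have linS := cuts_linearizes cutS.
have [q [q_mono q_surj]] := monotone_onto_ord linS.1 e_inj.
pose c4 := cyclic_of_linear (@ltn_ord_total 4).
have q_int J : is_interval c4 J -> is_interval (index_cyc Delta) (q @^-1` J).
  move=> /cyclic_of_linear_arc aJ; apply/linS.2; apply: arc_preimage aJ.
  move=> x y /q_mono; rewrite leq_eqVlt => /orP[/eqP/val_inj|]; by [right | left].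
pose F4 e := q (petal_of Delta e).
have F4_surj i : exists e, F4 e = i.
  have [x qx] := q_surj i; have [a ax] := petal_of_surj x.
  by exists a; rewrite /F4 ax.
have F4_le J : is_interval c4 J -> le (F4 @^-1` J).
  by move=> /q_int/interval_le.
pose D4 := pseudoflower_of_map F4_surj F4_le.
have concD4 : concatenation D4 Delta.
  exists q; split=> // x a /petal_ofP ax.
  by rewrite /= /F4 ax.
have fin4 : finite_set [set: petal_index D4] by exact: finite_finset.
have D4E J : nontrivial J -> lam (F4 @^-1` J) = Some k.-1 <-> is_interval c4 J.
  by move=> ntJ; rewrite -(daisyP D4 concD4 fin4 J ntJ) petal_union_of_map.
pose r x := q (g x).
have F4E J : F4 @^-1` J = f @^-1` (r @^-1` J).
  apply/seteqP; split=> a; rewrite /F4 /r /=;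
    by rewrite (_ : petal_of Delta a = g (f a)) //; apply/petal_ofP/g_sub/petal_ofP.
have arc4 i n : is_interval c4 (ordset (iota i n)).
  apply/cyclic_of_linear_arc; left=> x y z; rewrite /ordset /=.
  by rewrite !mem_iota; lia.
have arc4C J : is_interval c4 (~` J) -> is_interval c4 J.
  move=> /cyclic_of_linear_arc h; apply/cyclic_of_linear_arc.
  by case: h => [|]; [right | rewrite setCK; left].
pose Q s := r @^-1` ordset s.
have Q_arc s : is_interval c4 (ordset s) -> is_arc R (Q s).
  by move=> /q_int/g_int/linR.2.
have Q_ge s : is_interval c4 (ordset s) -> nontrivial (ordset s) -> ge (f @^-1` Q s).
  by move=> int nt; rewrite /Q -F4E; have /order_le_ge[] := (D4E _ nt).2 int.
have Q_le s : is_interval c4 (ordset s) -> le (f @^-1` Q s).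
  by move=> int; rewrite /Q -F4E; exact: (F4_le _ int).
have nt s : (exists2 i, i < 4 & i \in s) -> (exists2 i, i < 4 & i \notin s) ->
  nontrivial (ordset s) := @ordset_nontrivial s.
have r_surj i : i < 4 -> Q [:: i] !=set0.
  move=> i4; have [a Fa] := F4_surj (Ordinal i4); exists (f a).
  have : (F4 @^-1` ordset [:: i]) a by rewrite /= Fa /ordset /= inE.
  by rewrite F4E.
have r_lt x : (r x : nat) < 4 by exact: ltn_ord.
have n02 : ~ le (f @^-1` Q [:: 0; 2]).
  have nt02 : nontrivial (ordset [:: 0; 2]) by apply: nt; [exists 0 | exists 1].
  move=> le02; have /(D4E _ nt02) : lam (F4 @^-1` ordset [:: 0; 2]) = Some k.-1.
    apply/order_le_ge; rewrite F4E; split=> //.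
    apply: (uncross_ge (Q_le [:: 0; 1] (arc4 0 2))).
    - rewrite (_ : _ `|` _ = f @^-1` Q [:: 0; 1; 2]).
        by apply: Q_ge; [exact: arc4 0 3 | apply: nt; [exists 0 | exists 3]].
      by apply/seteqP; split=> a; rewrite /Q /ordset /= !inE; lia.
    - rewrite (_ : _ `&` _ = f @^-1` Q [:: 0]).
        by apply: Q_ge; [exact: arc4 0 1 | apply: nt; [exists 0 | exists 3]].
      by apply/seteqP; split=> a; rewrite /Q /ordset /= !inE; lia.
  pose o i (i4 : i < 4) := Ordinal i4.
  move=> /(_ (o 0 isT) (o 2 isT) isT isT) [//||].
  - by move=> /(_ (o 1 isT)) h; have : ordset [:: 0; 2] (o 1 isT) by apply: h; left.
  - by move=> /(_ (o 3 isT)) h; have : ordset [:: 0; 2] (o 3 isT) by apply: h; right; right.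
have quarterQ i j : i < 4 -> j < 4 -> is_interval c4 (ordset [:: i; j]) ->
    quarter R (fun J => ge (f @^-1` J)) (Q [:: i]) (Q [:: j]).
  move=> i4 j4 int; split.
  - exact: r_surj.
  - apply: Q_ge; first exact: arc4 i 1.
    apply: nt; first by exists i; rewrite ?inE.
    by exists (i == 0) => //; rewrite ?inE; case: (i).
  - exact: Q_arc (arc4 i 1).
  - rewrite (_ : _ `|` _ = Q [:: i; j]); first exact: Q_arc.
    by apply/seteqP; split=> a; rewrite /Q /ordset /= !inE; lia.
exists (Q [:: 0]), (Q [:: 1]), (Q [:: 2]), (Q [:: 3]); split.
- by move=> x; have := r_lt x; rewrite /Q /ordset /= !inE; lia.
- by split; apply: quarterQ => //; [exact: arc4 0 2 | exact: arc4 1 2].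
- split; apply: quarterQ => //; first exact: arc4 2 2.
  apply: arc4C; rewrite (_ : ~` _ = ordset [:: 1; 2]); first exact: arc4 1 2.
  apply/seteqP; split=> i; have := ltn_ord i; rewrite /ordset /= !inE; lia.
- rewrite (_ : _ `|` _ = Q [:: 0; 2]) //.
  by apply/seteqP; split=> a; rewrite /Q /ordset /= !inE; lia.
- rewrite -order_leC (_ : ~` _ = f @^-1` Q [:: 0; 2]) //.
  by apply/seteqP; split=> a; have := r_lt (f a); rewrite /Q /ordset /= !inE; lia.
Qed.

End DaisyQuartering.

(** * Maximality *)

Section Distinguished.
Variables (E : Type) (lam : connectivity E) (k : nat).
Hypothesis k_gt0 : 1 <= k.
Variable Phi : pseudoflower lam k.

Lemma displayed_distinguishes P Q :
  (exists2 S, displayed Phi S & distinguishes S P Q) ->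
  interval_distinguishes Phi P Q.
Proof. by move=> [_ [J [intJ _ ->]] dJ]; exists J. Qed.

Lemma interval_distinguishesC P Q :
  interval_distinguishes Phi P Q -> interval_distinguishes Phi Q P.
Proof. by move=> [J intJ dJ]; exists J => //; exact: distinguishesC. Qed.

(** The third profile orients the distinguishing set one way or the other. *)
Lemma interval_distinguishes_third A B C : is_profile lam k C ->
  interval_distinguishes Phi A B ->
  interval_distinguishes Phi A C \/ interval_distinguishes Phi B C.
Proof.
move=> hC [J intJ dJ]; have leJ := interval_le intJ.
have := profile_dich k_gt0 hC leJ; rewrite -petal_unionE => dichC.
have [|nd] := EM (distinguishes (petal_union J) A C).
  by left; exists J.
by right; exists J => //; move: dJ nd; rewrite /distinguishes; tauto.
Qed.

Lemma interval_distinguishes_before R P Q :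
  linearizes (index_cyc Phi) R -> is_profile lam k P -> is_profile lam k Q ->
  interval_distinguishes Phi P Q ->
  before R (petal_of Phi) P Q \/ before R (petal_of Phi) Q P.
Proof.
move=> linR hP hQ [J intJ]; rewrite petal_unionE => dJ.
apply: (distinguishes_before k_gt0 linR.1 _ hP hQ _ dJ); last exact/linR.2.
by move=> J' cJ'; exact: convex_le linR cJ'.
Qed.

(** At most one of three pairwise distinguished profiles lives where [P] does. *)
Lemma two_others P T1 T2 T3 :
  is_profile lam k P ->
  interval_distinguishes Phi T1 T2 -> interval_distinguishes Phi T1 T3 ->
  interval_distinguishes Phi T2 T3 ->
  exists A B, [/\ A = T1 \/ A = T2, B = T2 \/ B = T3,
    interval_distinguishes Phi A B, interval_distinguishes Phi A P
    & interval_distinguishes Phi B P].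
Proof.
move=> hP d12 d13 d23.
have [d1|d2] := interval_distinguishes_third hP d12.
  have [d2|d3] := interval_distinguishes_third hP d23.
    by exists T1, T2; split; auto.
  by exists T1, T3; split; auto.
have [d1|d3] := interval_distinguishes_third hP d13.
  by exists T1, T2; split; auto.
by exists T2, T3; split; auto.
Qed.

End Distinguished.

Theorem lemma7p8 (E : Type) (lam : connectivity E) (k : nat) (hk : 1 <= k)
  (PP : set (set (set E)))
  (PP_profile : forall P, PP P -> is_profile lam k P)
  (PP_truncation : forall P Q, PP P -> PP Q ->
     truncation lam k P = truncation lam k Q)
  (Phi : pseudoflower lam k)
  (Phi_max : maximal_for (@concatenation E lam k) Phi)
  (Phi_daisy : exists Delta : pseudoflower lam k,
     is_daisy Delta /\ concatenation Delta Phi)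
  (Phi_three : distinguishes_three PP Phi) :
  maximal_for (profile_le (lam := lam) (k := k) PP) Phi.
Proof.
move=> Psi Phi_le P Q PP_P PP_Q dPsi; apply: contrapT => nPhi.
have [hP hQ] := (PP_profile P PP_P, PP_profile Q PP_Q).
have [P1 [P2 [PP_P1 PP_P2 d12 d1 d2]]] : exists P1 P2, [/\ PP P1, PP P2,
    interval_distinguishes Phi P1 P2, interval_distinguishes Phi P1 P
    & interval_distinguishes Phi P2 P].
  have [T1 [T2 [T3 [[h1 h2 h3] [d12 d13 d23]]]]] := Phi_three.
  have [A [B [eA eB dAB dA dB]]] := two_others hk hP (displayed_distinguishes d12)
    (displayed_distinguishes d13) (displayed_distinguishes d23).
  by exists A, B; split=> //; [case: eA => -> | case: eB => ->].
have [hP1 hP2] := (PP_profile P1 PP_P1, PP_profile P2 PP_P2).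
have dQ A : interval_distinguishes Phi A P -> interval_distinguishes Phi A Q.
  move=> dA; have [//|dPQ] := interval_distinguishes_third hk hQ dA.
  by case: nPhi.
have [dQ1 dQ2] := (dQ _ d1, dQ _ d2).
have [e0 _] : exists e : E, True.
  apply: contrapT => /forallNP noE; apply: (profile_neqT hk hP).
  have eqT (A : set E) : A = setT by apply/seteqP; split=> // e; case: (noE e).
  have leT : order_le lam k.-1 (petal_of Phi @^-1` setT).
    by apply: interval_le => x z _ _ _; left.
  by have [] := profile_dich hk hP leT; rewrite [X in P X -> _]eqT.
have [X leX [dPQ dP12]] : exists2 X, order_le lam k.-1 X &
    distinguishes X P Q /\ distinguishes X P1 P2.
  have [S cutS _] := cuts_at (index_cyc Psi) (petal_of Psi e0).
  have linS := cuts_linearizes cutS.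
  have bef A B : PP A -> PP B -> interval_distinguishes Psi A B ->
      before S (petal_of Psi) A B \/ before S (petal_of Psi) B A.
    by move=> /PP_profile hA /PP_profile hB; exact: interval_distinguishes_before.
  have bef' A B : PP A -> PP B -> interval_distinguishes Phi B A ->
      before S (petal_of Psi) A B \/ before S (petal_of Psi) B A.
    move=> hA hB dBA; apply: bef => //; apply: Phi_le => //.
    exact: interval_distinguishesC.
  have [J cJ dJ] := separate_pairs hk linS.1 (fun J => convex_le linS (J := J))
    hP hQ hP1 hP2 (bef _ _ PP_P PP_Q dPsi)
    (bef' _ _ PP_P1 PP_P2 (interval_distinguishesC d12))
    (bef' _ _ PP_P PP_P1 d1) (bef' _ _ PP_P PP_P2 d2)
    (bef' _ _ PP_Q PP_P1 dQ1) (bef' _ _ PP_Q PP_P2 dQ2).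
  by exists (petal_of Psi @^-1` J) => //; exact: convex_le linS cJ.
have agree J : is_interval (index_cyc Phi) J ->
    P (petal_of Phi @^-1` J) <-> Q (petal_of Phi @^-1` J).
  move=> intJ; apply: (undistinguished hk hP hQ); first exact: interval_le.
  by rewrite -petal_unionE => dJ; apply: nPhi; exists J.
have [[i0 P_i0]|[R linR P_end]] := profile_location hk (petal_of Phi e0) hP.
- have Q_i0 : Q (~` petal i0).
    have int0 : is_interval (index_cyc Phi) [set i0] by move=> x z -> ->.
    have [Q0|] := profile_dich hk hQ (interval_le int0); last by rewrite -petalE.
    by case: (profile_excl hk hP (iffRL (agree _ int0) Q0)); rewrite -petalE.
  have [S0 cutS0 S0_first] := cuts_at (index_cyc Phi) i0.
  have linR := linearizes_reverse (cuts_linearizes cutS0).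
  (* [P] and [Q], [P1] and [P2], or [X] and its complement may trade places *)
  have no_split A B A1 A2 D Y : PP A -> PP B -> PP A1 -> PP A2 ->
      A (~` petal i0) -> B (~` petal i0) -> interval_distinguishes Phi A2 A ->
      initial (fun x y => S0 y x) D ->
      A1 (~` (petal_of Phi @^-1` D)) -> A2 (petal_of Phi @^-1` D) ->
      A (~` Y) -> B Y -> A1 (~` Y) -> A2 Y -> False.
    move=> hA hB hA1 hA2 A0 B0 d2A iD A1D A2D AY BY A1Y A2Y.
    have bef := interval_distinguishes_before hk linR (PP_profile _ hA)
      (PP_profile _ hA2) (interval_distinguishesC d2A).
    have [Psi' le1 nle] := petal_splits hk linR S0_first (PP_profile _ hA)
      (PP_profile _ hB) (PP_profile _ hA1) (PP_profile _ hA2)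
      (PP_truncation _ _ hA hA1) (PP_truncation _ _ hA hA2) A0 B0 bef
      iD A1D A2D AY BY A1Y A2Y.
    exact: nle (Phi_max _ le1).
  have no_split_sym A1 A2 D Y : PP A1 -> PP A2 -> interval_distinguishes Phi A2 P ->
      interval_distinguishes Phi A2 Q ->
      initial (fun x y => S0 y x) D ->
      A1 (~` (petal_of Phi @^-1` D)) -> A2 (petal_of Phi @^-1` D) ->
      distinguishes Y P Q -> A1 (~` Y) -> A2 Y -> False.
    move=> h1 h2 dP dQ' iD A1D A2D [[PY QY]|[QY PY]] A1Y A2Y.
    + exact: (no_split Q P A1 A2 D Y).
    + exact: (no_split P Q A1 A2 D Y).
  have [] := interval_distinguishes_before hk linR hP1 hP2 d12.
  + move=> [D iD [P1D P2D]]; case: dP12 => [[P1X P2X]|[P2X P1X]].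
    * apply: (no_split_sym P1 P2 D (~` X)) => //; last by rewrite setCK.
      exact: distinguishes_setC.
    * exact: (no_split_sym P1 P2 D X).
  + move=> [D iD [P2D P1D]]; case: dP12 => [[P1X P2X]|[P2X P1X]].
    * exact: (no_split_sym P2 P1 D X).
    * apply: (no_split_sym P2 P1 D (~` X)) => //; last by rewrite setCK.
      exact: distinguishes_setC.
- have tot := linR.1; have [ir _ tt] := tot.
  have f_le J : convex R J -> order_le lam k.-1 (petal_of Phi @^-1` J).
    exact: convex_le.
  have Q_end x : Q (petal_of Phi @^-1` [set y | ~ R x y]).
    apply/agree => //; apply/linR.2; left; apply: initial_convex.
    exact: not_above_initial.
  (* [P1] and [P] differ on some proper initial segment, and those are small
     for [P] *)
  have [b1 P1b1] : exists b, ~ P1 (petal_of Phi @^-1` [set y | R y b]).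
    apply: contrapT => /forallNP P1_end.
    have small D : initial R D -> ~ (petal_of Phi @^-1` D = setT) ->
        P (petal_of Phi @^-1` D) /\ P1 (petal_of Phi @^-1` D).
      move=> iD nDT; have leD := f_le _ (initial_convex iD).
      have [e nDe] : exists e, ~ D (petal_of Phi e).
        apply: contrapT => /forallNP h; apply: nDT; apply/seteqP; split=> // e _.
        by apply: contrapT; exact: h.
      split.
        apply: (profile_sub hk hP leD _ (P_end (petal_of Phi e))) => e' De' /= h.
        by apply: nDe; apply: iD h.
      have /contrapT P1e := P1_end (petal_of Phi e).
      apply: (profile_sub hk hP1 leD _ P1e) => e' De' /=.
      have [eq|/tt[//|h]] := EM (petal_of Phi e' = petal_of Phi e).
        by case: nDe; rewrite -eq.
      by case: nDe; apply: iD h.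
    have nT A D : PP A -> A (petal_of Phi @^-1` D) -> ~ (petal_of Phi @^-1` D = setT).
      by move=> /PP_profile hA + e; rewrite e; exact: (profile_neqT hk hA).
    have [] := interval_distinguishes_before hk linR hP1 hP d1 => -[D iD [h1 h2]].
      have [_ h3] := small D iD (nT _ _ PP_P h2).
      exact: (profile_excl hk hP1 h3 h1).
    have [h3 _] := small D iD (nT _ _ PP_P1 h2).
    exact: (profile_excl hk hP h3 h1).
  have [Delta [daisy conc]] := Phi_daisy.
  have [A [B [C [D quart]]]] := daisy_quartering daisy conc linR.
  have contra Y : P (~` Y) -> Q Y -> False.
    move=> PY QY.
    exact: (no_quartering hk tot f_le hP hQ hP1 (PP_truncation _ _ PP_P PP_Q)
      (PP_truncation _ _ PP_P PP_P1) P_end Q_end P1b1 PY QY quart).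
  case: dPQ => [[PX QX]|[QX PX]]; last exact: contra PX QX.
  by apply: (contra (~` X)); rewrite ?setCK.
Qed.
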